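(* Let $n\in\mathbb N$ and let $H$ be a real or complex Hilbert space with $\dim H\geq n$. Suppose $\phi:P_n(H)\to P_n(H)$ is a map (not assumed surjective or injective) such that $\angle(\phi(P),\phi(Q))=\angle(P,Q)$ for all $P,Q\in P_n(H)$. If $n=1$ or $n\neq \dim H/2$, then there exists a linear or conjugate-linear isometry $V$ on $H$ such that $\phi(P)=VPV^*$ for all $P\in P_n(H)$. Moreover, if $H$ is infinite dimensional and $\phi:P_\infty(H)\to P_\infty(H)$ is a surjective map with $\angle(\phi(P),\phi(Q))=\angle(P,Q)$ for all $P,Q\in P_\infty(H)$, then there exists a unitary or antiunitary operator $U$ on $H$ such that $\phi(P)=UPU^*$ for all $P\in P_\infty(H)$.
   Context: A projection means a self-adjoint idempotent bounded operator on $H$. $P_n(H)$ denotes the set of all rank-$n$ projections on $H$, and $P_\infty(H)$ the set of all projections of infinite rank. For projections $P,Q,P',Q'$ on $H$, ''$\angle(P,Q)=\angle(P',Q')$'' (equality of principal angles) means by definition that the positive operators $QPQ$ and $Q'P'Q'$ are unitarily equivalent (orthogonally equivalent in the real case); for finite rank projections this is the same as equality, with multiplicities, of the eigenvalues of $QPQ$ and $Q'P'Q'$ (whose square roots are the cosines of the principal angles). For a conjugate-linear operator $V$, $V^*$ denotes the conjugate-linear operator with $\langle Vx,y\rangle=\overline{\langle x,V^*y\rangle}$ for all $x,y$; an isometry means $\|Vx\|=\|x\|$ for all $x$. *)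

(* Defs.v *)
From mathcomp Require Import all_boot all_order all_algebra.
From mathcomp Require Import reals complex.
Set Implicit Arguments. Unset Strict Implicit. Unset Printing Implicit Defensive.
Import Order.TTheory GRing.Theory Num.Theory.
Local Open Scope ring_scope.

Definition scal (R : realType) (b : bool) : numFieldType :=
  if b then (R[i] : numFieldType) else (R : numFieldType).

Definition cj (R : realType) (b : bool) : scal R b -> scal R b :=
  match b return scal R b -> scal R b with
  | true => @conjc R
  | false => id
  end.

Arguments scal : clear implicits.
Arguments cj : clear implicits.

Section Hilbert.
Variables (K : numFieldType) (conj : K -> K) (V : lmodType K) (ip : V -> V -> K).

Definition is_inner_product : Prop :=
  [/\ forall (a : K) (x y z : V), ip (a *: x + y) z = a * ip x z + ip y z,
      forall x y : V, ip y x = conj (ip x y),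
      forall x : V, 0 <= ip x x
    & forall x : V, ip x x = 0 -> x = 0].

(* ip x x is the squared norm; completeness w.r.t. the induced norm *)
Definition cauchy_seq (u : nat -> V) : Prop :=
  forall e : K, 0 < e -> exists N : nat, forall m k : nat, (N <= m)%N -> (N <= k)%N ->
    ip (u m - u k) (u m - u k) < e.

Definition converges_to (u : nat -> V) (l : V) : Prop :=
  forall e : K, 0 < e -> exists N : nat, forall m : nat, (N <= m)%N ->
    ip (u m - l) (u m - l) < e.

Definition is_complete : Prop :=
  forall u : nat -> V, cauchy_seq u -> exists l : V, converges_to u l.

Definition is_hilbert : Prop := is_inner_product /\ is_complete.

Definition lin_indep (n : nat) (v : 'I_n -> V) : Prop :=
  forall c : 'I_n -> K, \sum_(i < n) c i *: v i = 0 -> forall i, c i = 0.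

Definition subspace_has_dim (S : V -> Prop) (d : nat) : Prop :=
  exists v : 'I_d -> V, (forall i, S (v i)) /\ lin_indep v /\
    (forall y, S y -> exists c : 'I_d -> K, y = \sum_(i < d) c i *: v i).

Definition has_dim (d : nat) : Prop := subspace_has_dim (fun _ => True) d.

Definition dim_ge (n : nat) : Prop := exists v : 'I_n -> V, lin_indep v.

Definition inf_dim : Prop := forall n : nat, dim_ge n.

Definition is_linear (T : V -> V) : Prop :=
  forall (a : K) (x y : V), T (a *: x + y) = a *: T x + T y.

Definition is_conj_linear (T : V -> V) : Prop :=
  forall (a : K) (x y : V), T (a *: x + y) = conj a *: T x + T y.

Definition is_bounded (T : V -> V) : Prop :=
  exists M : K, forall x, ip (T x) (T x) <= M * ip x x.

Definition is_isometry (T : V -> V) : Prop := forall x, ip (T x) (T x) = ip x x.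

Definition is_adjoint (T T' : V -> V) : Prop := forall x y, ip (T x) y = ip x (T' y).

Definition is_conj_adjoint (T T' : V -> V) : Prop :=
  forall x y, ip (T x) y = conj (ip x (T' y)).

Definition is_projection (P : V -> V) : Prop :=
  [/\ is_linear P, is_bounded P, forall x, P (P x) = P x & is_adjoint P P].

Definition range (T : V -> V) (y : V) : Prop := exists x, y = T x.

Definition proj_rank (n : nat) (P : V -> V) : Prop :=
  is_projection P /\ subspace_has_dim (range P) n.

Definition proj_inf_rank (P : V -> V) : Prop :=
  is_projection P /\
  forall m : nat, exists v : 'I_m -> V, (forall i, range P (v i)) /\ lin_indep v.

Definition h_unitary (W : V -> V) : Prop :=
  [/\ is_linear W, is_isometry W & forall y, exists x, y = W x].

Definition h_antiunitary (W : V -> V) : Prop :=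
  [/\ is_conj_linear W, is_isometry W & forall y, exists x, y = W x].

(* A and B are unitarily (orthogonally) equivalent: B = W A W^* for a unitary W *)
Definition unit_equiv (A B : V -> V) : Prop :=
  exists W : V -> V, h_unitary W /\ forall x, W (A x) = B (W x).

Definition angle_eq (P Q P' Q' : V -> V) : Prop :=
  unit_equiv (Q \o P \o Q) (Q' \o P' \o Q').

End Hilbert.

(* Main.v *)
(** Finite rank.  Unitary equivalence of [QPQ] and [Q'P'Q'] gives equality of
    traces and preserves commutation.  Given a unit vector [x], complete it to an
    orthonormal system [X_0 = x, ..., X_n]; the images of the [n + 1] coordinate
    projections of rank [n] commute, so in a joint eigenbasis they become
    [n]-subsets of a finite set that pairwise meet in [n - 1] points.  Such a
    family either lies in one [(n + 1)]-subset, and then the combination of the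
    coordinate projections that equals the projection onto [x] is mapped to a
    projection onto a line [chi x], or it contains a common [(n - 1)]-subset; the
    latter needs [dim H >= 2n], and is impossible when [dim H > 2n] by comparison
    with a second system that meets the first one only in [x].  By preservation of
    the trace, [chi] preserves the angles between lines and is compatible with
    [phi], so Wigner's theorem (in its non-surjective form, proved following
    Bargmann) provides the isometry.

    Infinite rank.  On projections of infinite rank and corank, [phi] preserves
    orthogonality in both directions, hence order and the covering relation
    [M < M + x], which yields a map on lines.  The spectrum of [QPQ] shows that it
    preserves angles, and Wigner's theorem applies again.  Projections of finite
    corank are determined by the projections commuting with them. *)

Require Import Defs.
From mathcomp Require Import all_boot all_order all_algebra.
From mathcomp Require Import boolp reals complex.
From mathcomp Require Import ring zify.
Set Implicit Arguments. Unset Strict Implicit. Unset Printing Implicit Defensive.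
Import Order.TTheory GRing.Theory Num.Theory.
Local Open Scope ring_scope.

(** * Scalar fields with conjugation *)

(** The excluded dimension [2n] is a real obstruction. There [P |-> I - P] preserves principal
    angles, and it turns the coordinate projections of a system into [n]-sets with [n - 1] common
    points. For [n > 1] no isometry does that. So dimension must enter exactly where the second type
    of family is ruled out.

    The map is never extended linearly. A fixed combination of [n + 1] commuting projections yields
    a line, and traces of products of such combinations are sums of traces [tr(PQ)], which are
    preserved one by one.

    In infinite rank there is no trace, so the angle between two lines has to be found as an
    eigenvalue of [QPQ], next to the eigenvalues 0 and 1 that may be there for other reasons.
    Moreover, order is read off orthogonality through complements, and the complement of a
    projection of finite corank is outside the domain of [phi]. This is why such projections are
    treated apart. Surjectivity is what brings complements of images back into the image. *)

(** Common interface of the real and the complex scalars. The complex order is partial, so square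
    roots and infima are asked for among nonnegative elements only. [real_or_complex] serves to
    decide between linear and conjugate-linear in Wigner's theorem. *)
Record conj_field (K : numFieldType) (conj : K -> K) : Prop := ConjField {
  conjD : {morph conj : a b / a + b};
  conjM : {morph conj : a b / a * b};
  conjK : involutive conj;
  mul_conj : forall a, a * conj a = `|a| ^+ 2;
  conj_nneg : forall a : K, 0 <= a -> conj a = a;
  exists_sqrt : forall a : K, 0 <= a -> exists2 r, 0 <= r & r ^+ 2 = a;
  inv_nat_lt : forall e : K, 0 < e -> exists N : nat, N.+1%:R^-1 < e;
  exists_inf : forall A : K -> Prop, (exists a, A a) -> (forall a, A a -> 0 <= a) ->
    exists m : K, [/\ 0 <= m, forall a, A a -> m <= a &
                  forall e : K, 0 < e -> exists2 a, A a & a < m + e];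
  real_or_complex : (forall a, conj a = a) \/
    exists j, [/\ j * j = -1, conj j = - j &
      forall a, exists p q, [/\ conj p = p, conj q = q & a = p + q * j]] }.

Lemma real_exists_inf (R : realType) (A : R -> Prop) :
  (exists a, A a) -> (forall a, A a -> 0 <= a) ->
  exists m, [/\ 0 <= m, forall a, A a -> m <= a &
                forall e, 0 < e -> exists2 a, A a & a < m + e].
Proof.
move=> [a0 Aa0] A_ge0.
have hasA : classical_sets.has_inf (A : classical_sets.set R).
  split; first by exists a0.
  by exists 0 => a /A_ge0.
exists (inf (A : classical_sets.set R)); split.
- by apply: lb_le_inf; [exists a0 | move=> a /A_ge0].
- by move=> a Aa; apply: ge_inf => //; case: hasA.
- by move=> e e_gt0; have [a Aa lt] := inf_adherent e_gt0 hasA; exists a.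
Qed.

Lemma real_inv_nat_lt (R : realType) (e : R) : 0 < e -> exists N : nat, N.+1%:R^-1 < e.
Proof.
move=> e_gt0; exists (Num.trunc e^-1).
rewrite invf_plt ?posrE ?ltr0Sn //.
by apply: truncnS_gt.
Qed.

Lemma conj_field_scal (R : realType) (b : bool) : conj_field (cj R b).
Proof.
case: b; last first.
  split=> //=.
  - by move=> a; rewrite -normrX ger0_norm ?sqr_ge0 // expr2.
  - by move=> a a0; exists (Num.sqrt a); rewrite ?sqrtr_ge0 ?sqr_sqrtr.
  - exact: real_inv_nat_lt.
  - exact: real_exists_inf.
  - by left.
split.
- exact: rmorphD.
- exact: rmorphM.
- exact: conjcK.
- by move=> a; rewrite sqr_normc.
- by move=> [a c]; rewrite lecE => /andP[/eqP /= ->]; rewrite oppr0.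
- move=> [a c]; rewrite lecE => /andP[/eqP /= -> a0].
  exists ((Num.sqrt a)%:C)%C; first by rewrite ler0c sqrtr_ge0.
  by rewrite -rmorphXn sqr_sqrtr.
- move=> [a c]; rewrite ltcE => /andP[/eqP /= -> /real_inv_nat_lt[N leN]].
  by exists N; rewrite complexr0 -(rmorph_nat (real_complex R)) -fmorphV ltcR.
- move=> A [a0 Aa0] A_ge0.
  (* Nonnegative complex numbers are real, so the infimum can be taken in [R]. *)
  have AE a : A a -> a = (complex.Re a)%:C%C by move/A_ge0/ger0_Im; case: a => x y /= ->.
  have [||m [m0 mlb madh]] := @real_exists_inf R (fun x => A x%:C%C).
  + by exists (complex.Re a0); rewrite -AE.
  + by move=> x /A_ge0; rewrite ler0c.
  exists m%:C%C; split; first by rewrite ler0c.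
  + by move=> a Aa; rewrite (AE _ Aa) lecR; apply: mlb; rewrite -AE.
  + move=> [e f]; rewrite ltcE => /andP[/eqP /= -> /madh[a Aa lt]].
    by exists a%:C%C => //; rewrite complexr0 -rmorphD ltcR.
- right; exists 'i%C; split.
  + by rewrite -expr2 sqr_i.
  + by rewrite /=; apply/eqP; rewrite eq_complex /= oppr0 !eqxx.
  + move=> a; exists (complex.Re a)%:C%C, (complex.Im a)%:C%C; split; rewrite /= ?oppr0 //.
    by rewrite mulrC -complexE.
Qed.

(** * Families of sets pairwise meeting in all but one point *)

Section SetFamily.
Variables (n d : nat) (F : 'I_n.+1 -> {set 'I_d}).
Hypothesis n_gt0 : (0 < n)%N.
Hypothesis card_F : forall i, #|F i| = n.
Hypothesis card_FI : forall i j, i != j -> #|F i :&: F j| = n.-1.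

Lemma family_inj i j : F i = F j -> i = j.
Proof.
move=> Fij; apply/eqP/negPn/negP => /card_FI; rewrite Fij setIid card_F.
by move: n_gt0; lia.
Qed.

Lemma card_familyD i j : i != j -> #|F i :\: F j| = 1%N.
Proof. by move=> ij; rewrite cardsD card_F card_FI //; move: n_gt0; lia. Qed.

Lemma sum_mem_family l : (\sum_i (l \in F i))%N = #|[set i | l \in F i]|.
Proof. by rewrite -sum1dep_card [RHS]big_mkcond; apply: eq_bigr => i _; case: ifP. Qed.

(** Double counting: each of the [n] sets other than [F ord0] has exactly one point outside
    [F ord0]. *)
Lemma sum_mem_family_off : (\sum_(l | l \notin F ord0) \sum_i (l \in F i))%N = n.
Proof.
rewrite exchange_big /= big_ord_recl /= big1 => [|l]; last by move/negPf->.
rewrite add0n -[RHS]muln1 -[in RHS](card_ord n) -sum_nat_const; apply: eq_bigr => i _.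
rewrite -(@card_familyD (lift ord0 i) ord0); last by rewrite eq_sym neq_lift.
rewrite -sum1_card big_mkcond [RHS]big_mkcond; apply: eq_bigr => l _.
by rewrite inE; case: (l \in F ord0); case: (l \in _).
Qed.

(** The [n] outside points counted by [sum_mem_family_off] are then distinct, so the complement of
    [F ord0] has at least [n] elements. *)
Lemma family_star_dim : (forall l, l \notin F ord0 -> (\sum_i (l \in F i) <= 1)%N) ->
  (n + n <= d)%N.
Proof.
move=> le1; have : (n <= #|~: F ord0|)%N.
  rewrite -[X in (X <= _)%N]sum_mem_family_off -sum1_card.
  rewrite [X in (_ <= X)%N](eq_bigl (fun l => l \notin F ord0)); last by move=> l; rewrite inE.
  exact: leq_sum.
by have := cardsC (F ord0); rewrite card_F card_ord; lia.
Qed.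

(** Suppose [F l] has an outside point other than [k]. A set [F a] containing [k] has no further
    outside point, so it meets [F l] inside [F ord0], and cardinalities force
    [F a = k |: (F l :&: F ord0)]. This does not depend on [a], so [F i = F j]. *)
Lemma family_sub k i j : k \notin F ord0 -> i != j -> k \in F i -> k \in F j ->
  forall l, F l \subset k |: F ord0.
Proof.
move=> k0 ij ki kj l; apply/subsetP => k' k'l; rewrite !inE -implyNb; apply/implyP => k'k.
apply/negPn/negP => k'0.
have l0 : l != ord0 by apply: contraNneq k'0 => <-.
have only a x y : x \in F a -> x \notin F ord0 -> y \in F a -> y \notin F ord0 -> x = y.
  move=> xa x0 ya y0.
  have /card_familyD/eqP/cards1P[z Ez] : a != ord0 by apply: contraNneq x0 => <-.
  have : x \in F a :\: F ord0 by rewrite inE x0 xa.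
  have : y \in F a :\: F ord0 by rewrite inE y0 ya.
  by rewrite Ez !inE => /eqP -> /eqP ->.
have kl : k \notin F l by apply: contraNN k'k => kl; rewrite (only l k' k).
have same a : k \in F a -> F a = k |: (F l :&: F ord0).
  move=> ka; have la : l != a by apply: contraNneq kl => ->.
  have a0 : a != ord0 by apply: contraNneq k0 => <-.
  have sub : F l :&: F a \subset F ord0.
    apply/subsetP => x; rewrite inE => /andP[xl xa]; apply/negPn/negP => x0.
    by move: kl; rewrite -(only a x k) // xl.
  have El : F l :&: F a = F l :&: F ord0.
    apply/eqP; rewrite eqEcard !card_FI // leqnn andbT.
    by rewrite subsetI subsetIl.
  have Ea : F l :&: F a = F a :&: F ord0.
    apply/eqP; rewrite eqEcard !card_FI // leqnn andbT.
    by rewrite subsetI subsetIr.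
  rewrite -El Ea; apply/setP => x; rewrite !inE.
  have [->|xk] := eqVneq x k; first by rewrite ka.
  rewrite /=; case xa: (x \in F a) => //=; apply/esym/negPn/negP => x0.
  by move/eqP: xk; apply; apply: (only a).
by move/eqP: ij; apply; apply: family_inj; rewrite (same i ki) (same j kj).
Qed.

(** In the first case all sets lie in [G = k |: F ord0], which has [n + 1] points. Each set omits
    one point of [G], different sets omit different points, so every point of [G] lies in exactly
    [n] sets. *)
Lemma family_dichotomy :
  (exists k, forall l, (\sum_i (l \in F i) = n * ((l \in F ord0) + (l == k)))%N) \/
  (forall l, l \notin F ord0 -> (\sum_i (l \in F i) <= 1)%N).
Proof.
have [/existsP[k /andP[k0]]|/existsPn no] :=
    boolP [exists k, (k \notin F ord0) && (1 < \sum_i (k \in F i))%N]; last first.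
  by right=> l l0; move: (no l); rewrite l0 /= -leqNgt.
rewrite sum_mem_family => /card_gt1P[i [j [ki kj ij]]]; left; exists k => l.
rewrite !inE in ki kj.
have sub := family_sub k0 ij ki kj.
pose G := k |: F ord0; have cG : #|G| = n.+1 by rewrite cardsU1 k0 card_F.
have /fin_all_exists[g gE] a : exists g, G :\: F a = [set g].
  apply/cards1P; rewrite cardsD cG (setIidPr _) ?card_F ?sub //.
  by rewrite subSn // subnn.
have FG a : F a = G :\ g a.
  rewrite -gE setDDr setDv set0U; apply/esym/setIidPr; exact: sub.
have g_inj : injective g by move=> a c ac; apply: family_inj; rewrite !FG ac.
have gG : g @: setT = G.
  apply/eqP; rewrite eqEcard cG card_imset // cardsT card_ord leqnn andbT.
  apply/subsetP => x /imsetP[a _ ->].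
  have : g a \in G :\: F a by rewrite gE set11.
  by case/setDP.
have -> : ((l \in F ord0) + (l == k))%N = (l \in G).
  rewrite !inE; have [->|_] := eqVneq l k; first by rewrite (negPf k0).
  by rewrite addn0.
have [|lG] := boolP (l \in G); last first.
  by rewrite muln0 big1 // => a _; rewrite FG in_setD1 (negPf lG) andbF.
rewrite muln1 -gG => /imsetP[a _ ->].
rewrite (bigD1 a) //= {1}FG in_setD1 eqxx add0n.
rewrite (eq_bigr (fun _ => 1%N)) ?sum1_card => [|c ca].
  by rewrite cardC1 card_ord.
by rewrite FG in_setD1 (inj_eq g_inj) eq_sym ca -gG imset_f.
Qed.

End SetFamily.
(** * Inner product spaces *)

Section HilbertSpace.
Variables (K : numFieldType) (conj : K -> K) (H : lmodType K) (ip : H -> H -> K).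
Hypothesis cK : conj_field conj.
Hypothesis ipP : is_inner_product conj ip.

Lemma conj0 : conj 0 = 0.
Proof. exact: conj_nneg. Qed.

Lemma conj1 : conj 1 = 1.
Proof. exact: conj_nneg. Qed.

Lemma conjN a : conj (- a) = - conj a.
Proof. by apply/eqP; rewrite -addr_eq0 -(conjD cK) addNr conj0. Qed.

Lemma ipC x y : ip y x = conj (ip x y).
Proof. by case: ipP. Qed.

Lemma ip_ge0 x : 0 <= ip x x.
Proof. by case: ipP. Qed.

Lemma ipDl x y z : ip (x + y) z = ip x z + ip y z.
Proof. by case: ipP => lin _ _ _; have := lin 1 x y z; rewrite scale1r mul1r. Qed.

Lemma ip0l z : ip 0 z = 0.
Proof. by apply: (addrI (ip 0 z)); rewrite -ipDl !addr0. Qed.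

Lemma ip_eq0 x : (ip x x == 0) = (x == 0).
Proof. by case: ipP => _ _ _ def; apply/eqP/eqP => [/def // | ->]; exact: ip0l. Qed.

Lemma ipZl a x z : ip (a *: x) z = a * ip x z.
Proof. by case: ipP => lin _ _ _; have := lin a x 0 z; rewrite ip0l !addr0. Qed.

Lemma ipNl x z : ip (- x) z = - ip x z.
Proof. by rewrite -scaleN1r ipZl mulN1r. Qed.

Lemma ipBl x y z : ip (x - y) z = ip x z - ip y z.
Proof. by rewrite ipDl ipNl. Qed.

Lemma ip_suml (I : finType) (A : {pred I}) (F : I -> H) z :
  ip (\sum_(i in A) F i) z = \sum_(i in A) ip (F i) z.
Proof. by rewrite (big_morph (ip^~ z) (fun x y => ipDl x y z) (ip0l z)). Qed.

Lemma ip0r z : ip z 0 = 0.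
Proof. by rewrite ipC ip0l conj0. Qed.

Lemma ipDr x y z : ip z (x + y) = ip z x + ip z y.
Proof. by rewrite ipC ipDl (conjD cK) -!ipC. Qed.

Lemma ipZr a x z : ip z (a *: x) = conj a * ip z x.
Proof. by rewrite ipC ipZl (conjM cK) -ipC. Qed.

Lemma ipNr x z : ip z (- x) = - ip z x.
Proof. by rewrite ipC ipNl conjN -ipC. Qed.

Lemma ipBr x y z : ip z (x - y) = ip z x - ip z y.
Proof. by rewrite ipDr ipNr. Qed.

Lemma ip_sumr (I : finType) (A : {pred I}) (F : I -> H) z :
  ip z (\sum_(i in A) F i) = \sum_(i in A) ip z (F i).
Proof.
by rewrite (big_morph (ip z) (fun x y => ipDr x y z) (ip0r z)).
Qed.

Lemma ip_sym0 x y : ip x y = 0 -> ip y x = 0.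
Proof. by move=> xy; rewrite ipC xy conj0. Qed.

Lemma sqr_norm_ip x y : `|ip x y| ^+ 2 = ip x y * ip y x.
Proof. by rewrite -(mul_conj cK) -ipC. Qed.

Lemma norm_conj a : `|conj a| = `|a|.
Proof.
apply/eqP; rewrite -(eqrXn2 (n := 2)) //.
by rewrite -!(mul_conj cK) (conjK cK) mulrC.
Qed.

Lemma norm_ipC x y : `|ip x y| = `|ip y x|.
Proof. by rewrite ipC norm_conj. Qed.

Lemma ip_injl x y : (forall z, ip x z = ip y z) -> x = y.
Proof.
move=> xy; apply/eqP; rewrite -subr_eq0 -ip_eq0 ipBl xy subrr //.
Qed.

Lemma ip_resid x u : ip u u = 1 ->
  ip (x - ip x u *: u) (x - ip x u *: u) = ip x x - `|ip x u| ^+ 2.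
Proof.
move=> uu; rewrite !(ipBl, ipBr, ipZl, ipZr) uu -ipC sqr_norm_ip mulr1; ring.
Qed.

Lemma norm_ip_le x u : ip u u = 1 -> `|ip x u| ^+ 2 <= ip x x.
Proof. by move=> uu; rewrite -subr_ge0 -ip_resid // ip_ge0. Qed.

Lemma norm_ip_eq x u : ip u u = 1 -> `|ip x u| ^+ 2 = ip x x -> x = ip x u *: u.
Proof.
by move=> uu xu; apply/eqP; rewrite -subr_eq0 -ip_eq0 ip_resid // xu subrr.
Qed.

Lemma exists_unit x : x != 0 -> exists2 a, a > 0 & ip (a *: x) (a *: x) = 1.
Proof.
move=> x0; have xx : 0 < ip x x by rewrite lt_def ip_ge0 ip_eq0 x0.
have [r r0 rr] := exists_sqrt cK (ip_ge0 x).
have r_gt0 : 0 < r by rewrite lt_def r0 andbT -sqrf_eq0 rr (gt_eqF xx).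
exists r^-1; first by rewrite invr_gt0.
rewrite ipZl ipZr (conj_nneg cK) ?invr_ge0 // mulrA -rr; field.
by rewrite gt_eqF.
Qed.

Lemma cauchy_schwarz x y : `|ip x y| ^+ 2 <= ip x x * ip y y.
Proof.
have [->|y0] := eqVneq y 0; first by rewrite !ip0r normr0 expr0n mulr0.
have [a a0 ua] := exists_unit y0.
have := norm_ip_le x ua; rewrite ipZr (conj_nneg cK (ltW a0)) normrM exprMn.
rewrite (gtr0_norm a0) -(ler_pM2r (x := ip y y)); last first.
  by rewrite lt_def ip_ge0 ip_eq0 y0.
by rewrite mulrAC; move: ua; rewrite ipZl ipZr (conj_nneg cK (ltW a0)) mulrA -expr2 => ->;
  rewrite mul1r.
Qed.

Lemma linear_add (T : H -> H) : is_linear T -> forall x y, T (x + y) = T x + T y.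
Proof. by move=> lT x y; have := lT 1 x y; rewrite !scale1r. Qed.

Lemma linear0 (T : H -> H) : is_linear T -> T 0 = 0.
Proof. by move=> lT; apply: (addrI (T 0)); rewrite -(linear_add lT) !addr0. Qed.

Lemma linear_scale (T : H -> H) : is_linear T -> forall a x, T (a *: x) = a *: T x.
Proof. by move=> lT a x; have := lT a x 0; rewrite (linear0 lT) !addr0. Qed.

Lemma linear_sub (T : H -> H) : is_linear T -> forall x y, T (x - y) = T x - T y.
Proof. by move=> lT x y; rewrite (linear_add lT) -scaleN1r (linear_scale lT) scaleN1r. Qed.

Lemma linear_sum (T : H -> H) (I : finType) (A : {pred I}) (F : I -> H) :
  is_linear T -> T (\sum_(i in A) F i) = \sum_(i in A) T (F i).
Proof. by move=> lT; rewrite (big_morph T (linear_add lT) (linear0 lT)). Qed.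

(** Polarization for both scalar fields at once: the defect [d] satisfies a linear identity for
    every scalar [a], and [a := d] turns it into [2 |d|^2 = 0]. *)
Lemma isometry_ip (W : H -> H) : is_linear W -> is_isometry ip W ->
  forall x y, ip (W x) (W y) = ip x y.
Proof.
move=> lW iW x y; set d := ip (W x) (W y) - ip x y.
have key a : conj a * d + a * conj d = 0.
  have := iW (x + a *: y); rewrite (linear_add lW) (linear_scale lW).
  rewrite !(ipDl, ipDr, ipZl, ipZr) !iW (ipC x y) (ipC (W x) (W y)) /d.
  rewrite (conjD cK) conjN => E.
  by move/eqP: E; rewrite -subr_eq0 => /eqP E; rewrite -[RHS]E; ring.
have := key d; rewrite mulrC -mulr2n => /eqP; rewrite mulrn_eq0 /= (mul_conj cK).
by rewrite sqrf_eq0 normr_eq0 subr_eq0 => /eqP.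
Qed.

Lemma proj_lin P : is_projection ip P -> is_linear P. Proof. by case. Qed.
Lemma proj_idem P : is_projection ip P -> forall x, P (P x) = P x. Proof. by case. Qed.
Lemma proj_adj P : is_projection ip P -> forall x y, ip (P x) y = ip x (P y). Proof. by
  case. Qed.

Lemma proj_ip P : is_projection ip P -> forall x y, ip (P x) (P y) = ip (P x) y.
Proof. by move=> pP x y; rewrite -(proj_adj pP) (proj_idem pP). Qed.

Lemma proj_pythag P x : is_projection ip P -> ip x x = ip (P x) (P x) + ip (x - P x) (x - P x).
Proof.
move=> pP; rewrite !(ipBl, ipBr) (proj_ip pP) -(proj_adj pP x x); ring.
Qed.

Lemma proj_le P x : is_projection ip P -> ip (P x) (P x) <= ip x x.
Proof. by move=> pP; rewrite (proj_pythag x pP) lerDl ip_ge0. Qed.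

Lemma proj_fixed P x : is_projection ip P -> ip (P x) x = ip x x -> P x = x.
Proof.
move=> pP E; apply/esym/eqP; rewrite -subr_eq0 -ip_eq0.
by have /eqP := proj_pythag x pP;
  rewrite proj_ip // E -[X in X == _]addr0 (inj_eq (addrI _)) eq_sym.
Qed.

Lemma projI P : is_linear P -> (forall x, P (P x) = P x) -> is_adjoint ip P P ->
  is_projection ip P.
Proof.
move=> lP iP aP; split=> //; exists 1 => x; rewrite mul1r.
have -> : ip x x = ip (P x) (P x) + ip (x - P x) (x - P x).
  rewrite !(ipBl, ipBr) -(aP (P x) x) iP -(aP x x); ring.
by rewrite lerDl ip_ge0.
Qed.

Lemma proj_ext P Q : is_projection ip P -> is_projection ip Q ->
  (forall x, P (Q x) = Q x) -> (forall x, Q (P x) = P x) -> P = Q.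
Proof.
move=> pP pQ PQ QP; apply/funext => x; apply: ip_injl => z.
by rewrite -QP (proj_adj pQ) (proj_adj pP) PQ -(proj_adj pQ).
Qed.

(** * Orthonormal families and projections of finite rank *)

Definition orthonormal (I : finType) (e : I -> H) :=
  forall i j, ip (e i) (e j) = (i == j)%:R.

(** For orthonormal [e], the projection onto the span of the [e i] with [i \in A]. The subset is
    kept apart from the family so that commuting projections can share one [e]. *)
Definition pj (I : finType) (A : {set I}) (e : I -> H) (x : H) :=
  \sum_(i in A) ip x (e i) *: e i.

Lemma ip_pj (I : finType) (A : {set I}) (e : I -> H) x y :
  ip (pj A e x) y = \sum_(i in A) ip x (e i) * ip (e i) y.
Proof. by rewrite ip_suml; apply: eq_bigr => i _; rewrite ipZl. Qed.

Lemma on_unit (I : finType) (e : I -> H) i : orthonormal e -> ip (e i) (e i) = 1.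
Proof. by move=> oe; rewrite oe eqxx. Qed.

Lemma ip_pj_on (I : finType) (A : {set I}) (e : I -> H) x j : orthonormal e ->
  ip (pj A e x) (e j) = if j \in A then ip x (e j) else 0.
Proof.
move=> oe; rewrite ip_pj; case: ifP => jA.
  rewrite (bigD1 j) //= oe eqxx mulr1 big1 ?addr0 // => i /andP[_ ij].
  by rewrite oe (negPf ij) mulr0.
rewrite big1 // => i iA; rewrite oe; case: eqP => [ij|_]; last by rewrite mulr0.
by rewrite -ij iA in jA.
Qed.

Lemma pj_on (I : finType) (A : {set I}) (e : I -> H) j : orthonormal e ->
  pj A e (e j) = if j \in A then e j else 0.
Proof.
move=> oe; rewrite /pj; case: ifP => jA.
  rewrite (bigD1 j) //= oe eqxx scale1r big1 ?addr0 // => i /andP[_ ij].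
  by rewrite oe eq_sym (negPf ij) scale0r.
rewrite big1 // => i iA; rewrite oe; case: eqP => [ij|_]; last by rewrite scale0r.
by rewrite ij iA in jA.
Qed.

Lemma pj_linear (I : finType) (A : {set I}) (e : I -> H) : is_linear (pj A e).
Proof.
move=> a x y; rewrite /pj scaler_sumr -big_split /=; apply: eq_bigr => i _.
by rewrite ipDl ipZl scalerDl scalerA.
Qed.

Lemma pj_eq_fix (I : finType) (A : {set I}) (e : I -> H) T x : is_linear T ->
  (forall i, i \in A -> T (e i) = e i) -> T (pj A e x) = pj A e x.
Proof.
move=> lT Te; rewrite (linear_sum _ _ lT); apply: eq_bigr => i iA.
by rewrite (linear_scale lT) Te.
Qed.

Lemma proj_pj (I : finType) (A : {set I}) (e : I -> H) : orthonormal e ->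
  is_projection ip (pj A e).
Proof.
move=> oe; apply: projI; first exact: pj_linear.
  move=> x; apply: pj_eq_fix; first exact: pj_linear.
  by move=> i iA; rewrite pj_on // iA.
move=> x y; rewrite ip_pj ip_sumr; apply: eq_bigr => i _.
by rewrite ipZr -ipC mulrC.
Qed.

Lemma ip_pj_pj (I : finType) (A : {set I}) (e : I -> H) x :
  ip (pj A e x) x = \sum_(i in A) `|ip x (e i)| ^+ 2.
Proof. by rewrite ip_pj; apply: eq_bigr => i _; rewrite sqr_norm_ip. Qed.

Lemma bessel (I : finType) (A : {set I}) (e : I -> H) x : orthonormal e ->
  \sum_(i in A) `|ip x (e i)| ^+ 2 <= ip x x.
Proof.
move=> oe; rewrite -ip_pj_pj // -(proj_ip (proj_pj A oe)).
exact/proj_le/proj_pj.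
Qed.

Lemma on_lin_indep n (e : 'I_n -> H) : orthonormal e -> lin_indep e.
Proof.
move=> oe c sum0 i; have := ip0l (e i); rewrite -sum0 ip_suml (bigD1 i) //=.
rewrite ipZl oe eqxx mulr1 big1 ?addr0 // => j ji.
by rewrite ipZl oe (negPf ji) mulr0.
Qed.

Lemma exists_left_kernel m d (M : 'M[K]_(m, d)) : (d < m)%N ->
  exists c : 'rV[K]_m, c != 0 /\ c *m M = 0.
Proof.
move=> dm; have : kermx M != 0.
  rewrite -mxrank_eq0 mxrank_ker subn_eq0 -ltnNge.
  exact: leq_ltn_trans (rank_leq_col _) dm.
case/rowV0Pn => c /sub_kermxP cM c0; by exists c.
Qed.

Lemma lin_indep_le m d (v : 'I_m -> H) (w : 'I_d -> H) : lin_indep v ->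
  (forall i, exists c : 'I_d -> K, v i = \sum_(j < d) c j *: w j) -> (m <= d)%N.
Proof.
move=> iv /choice[C vC]; rewrite leqNgt; apply/negP => dm.
have [c [/eqP c0 cM]] := exists_left_kernel (\matrix_(i, j) C i j) dm.
apply: c0; apply/rowP => i; rewrite mxE; apply: (iv (fun i => c 0 i)).
under eq_bigr => k _ do rewrite vC scaler_sumr.
rewrite exchange_big /= big1 // => j _.
under eq_bigr => k _ do rewrite scalerA.
rewrite -scaler_suml; have /rowP/(_ j) := cM; rewrite !mxE.
by under eq_bigr => k _ do rewrite mxE; move=> ->; rewrite scale0r.
Qed.

(** Orthogonality to [l] is a system of fewer than [d] homogeneous equations in the [d]
    coefficients. With [exists_on] this takes the place of Gram-Schmidt. *)
Lemma exists_orth_unit d (w : 'I_d -> H) (l : seq H) : lin_indep w -> (size l < d)%N ->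
  exists u (c : 'I_d -> K), [/\ u = \sum_(i < d) c i *: w i, ip u u = 1 &
    forall y, y \in l -> ip u y = 0].
Proof.
move=> iw ld.
have [c [c0 cM]] := exists_left_kernel (\matrix_(i < d, j < size l) ip (w i) (nth 0 l j)) ld.
pose z := \sum_(i < d) c 0 i *: w i.
have z0 : z != 0.
  apply: contraNneq c0 => /iw c0; apply/eqP/rowP => i; by rewrite c0 mxE.
have [a a0 ua] := exists_unit z0.
exists (a *: z), (fun i => a * c 0 i); split=> //.
  by rewrite /z scaler_sumr; apply: eq_bigr => i _; rewrite scalerA.
move=> y yl; rewrite ipZl ip_suml.
have yl' : (index y l < size l)%N by rewrite index_mem.
have /rowP/(_ (Ordinal yl')) := cM; rewrite !mxE => E.
rewrite (_ : \sum_(i < d) _ = 0) ?mulr0 // -[RHS]E; apply: eq_bigr => i _.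
by rewrite ipZl mxE nth_index.
Qed.

Definition ocons n (u : H) (f : 'I_n -> H) (i : 'I_n.+1) : H :=
  if unlift ord0 i is Some j then f j else u.

Lemma ocons0 n u (f : 'I_n -> H) : ocons u f ord0 = u.
Proof. by rewrite /ocons unlift_none. Qed.

Lemma oconsS n u (f : 'I_n -> H) i : ocons u f (lift ord0 i) = f i.
Proof. by rewrite /ocons liftK. Qed.

Lemma on_ocons n u (f : 'I_n -> H) : ip u u = 1 -> orthonormal f ->
  (forall i, ip u (f i) = 0) -> orthonormal (ocons u f).
Proof.
move=> uu of_ uf i j.
case: (unliftP ord0 i) => [i'|] ->; case: (unliftP ord0 j) => [j'|] ->;
  rewrite ?oconsS ?ocons0 ?(inj_eq lift_inj) ?eqxx //.
by rewrite ip_sym0.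
Qed.

Lemma exists_on (S : H -> Prop) D :
  (forall l : seq H, (size l < D)%N ->
     exists u, [/\ S u, ip u u = 1 & forall y, y \in l -> ip u y = 0]) ->
  forall m (l : seq H), (size l + m <= D)%N ->
  exists f : 'I_m -> H, [/\ orthonormal f, forall i, S (f i) &
    forall i y, y \in l -> ip (f i) y = 0].
Proof.
move=> exS; elim=> [|m IH] l lm; first by exists (fun _ => 0); split; case.
have [|u [Su uu ul]] := exS l; first by lia.
have [|f [of_ Sf fl]] := IH (u :: l); first by rewrite /=; lia.
exists (ocons u f); split.
- apply: on_ocons => // i; apply: ip_sym0; apply: fl; exact: mem_head.
- by move=> i; case: (unliftP ord0 i) => [j|] ->; rewrite ?oconsS ?ocons0.
- move=> i y yl; case: (unliftP ord0 i) => [j|] ->; rewrite ?oconsS ?ocons0; last exact: ul.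
  by apply: fl; rewrite inE yl orbT.
Qed.

Lemma range_fix P y : is_projection ip P -> range P y <-> P y = y.
Proof.
move=> pP; split=> [[x ->]|<-]; first exact: proj_idem.
by exists y.
Qed.

Lemma range_sum P d (c : 'I_d -> K) (v : 'I_d -> H) : is_projection ip P ->
  (forall i, range P (v i)) -> range P (\sum_(i < d) c i *: v i).
Proof.
move=> pP rv; apply/(range_fix _ pP); rewrite (linear_sum _ _ (proj_lin pP)).
apply: eq_bigr => i _; rewrite (linear_scale (proj_lin pP)); congr (_ *: _).
exact/range_fix.
Qed.

(** Otherwise the range of [P] would contain a unit vector orthogonal to [f], hence [n + 1]
    independent vectors. *)
Lemma proj_rank_on n P (f : 'I_n -> H) : proj_rank ip n P -> orthonormal f ->
  (forall i, P (f i) = f i) -> P = pj setT f.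
Proof.
move=> [pP [v [rv [iv vP]]]] of_ Pf.
apply: proj_ext => //; first exact: proj_pj.
  move=> x; apply: pj_eq_fix => //; exact: proj_lin.
move=> x; apply/eqP; rewrite -subr_eq0; apply/negPn/negP => z0.
have [a a0 ua] := exists_unit z0.
move: ua; set u := _ *: _ => uu.
have uf i : ip u (f i) = 0.
  by rewrite ipZl ipBl ip_pj_on // inE subrr mulr0.
have of1 := on_ocons uu of_ uf.
suff : (n.+1 <= n)%N by rewrite ltnn.
apply: (lin_indep_le (w := v) (on_lin_indep of1)) => i.
apply: vP; apply/(range_fix _ pP).
case: (unliftP ord0 i) => [j|] ->; rewrite ?oconsS ?ocons0 //.
rewrite /u (linear_scale (proj_lin pP)) (linear_sub (proj_lin pP)) (proj_idem pP).
rewrite pj_eq_fix //; exact: proj_lin.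
Qed.

Lemma proj_rank_basis n P : proj_rank ip n P ->
  exists2 f : 'I_n -> H, orthonormal f & P = pj setT f.
Proof.
move=> rP; have [pP [v [rv [iv vP]]]] := rP.
have [|//|f [of_ rf _]] := @exists_on (range P) n _ n [::].
  move=> l ln; have [u [c [uc uu ul]]] := exists_orth_unit iv ln.
  exists u; split=> //; rewrite uc; exact: range_sum.
exists f => //; apply: proj_rank_on => // i; exact/range_fix.
Qed.

Lemma proj_rank_pj (I : finType) (A : {set I}) (e : I -> H) : orthonormal e ->
  proj_rank ip #|A| (pj A e).
Proof.
move=> oe; split; first exact: proj_pj.
exists (fun i => e (enum_val i)); split; [|split].
- move=> i; apply/range_fix; first exact: proj_pj.
  by rewrite pj_on // enum_valP.
- apply: on_lin_indep => i j; rewrite oe; congr (_%:R).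
  by rewrite (inj_eq enum_val_inj).
- move=> y [x ->]; exists (fun i => ip x (e (enum_val i))).
  by rewrite /pj big_enum_val.
Qed.

(** * The trace and principal angles *)

(** The trace of [QPQ] for [P = pj A e] and [Q = pj B f]. *)
Definition ptr (I J : finType) (A : {set I}) (e : I -> H) (B : {set J}) (f : J -> H) : K :=
  \sum_(i in A) \sum_(j in B) `|ip (e i) (f j)| ^+ 2.

Definition commuting (P Q : H -> H) := forall x, P (Q x) = Q (P x).

Definition orth (P Q : H -> H) := forall x, P (Q x) = 0.

(** Basis independence of the trace: [T] vanishes off the span of either system, and both sums
    expand to the same double sum over pairs. *)
Lemma trace_indep (I J : finType) (A : {set I}) (e : I -> H) (B : {set J}) (f : J -> H) T :
  is_adjoint ip T T -> orthonormal e -> orthonormal f ->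
  (forall x, T (pj A e x) = T x) -> (forall x, T (pj B f x) = T x) ->
  \sum_(i in A) ip (T (e i)) (e i) = \sum_(j in B) ip (T (f j)) (f j).
Proof.
move=> aT oe of_ Te Tf.
have Tpj x : pj B f (T x) = T x.
  apply: ip_injl => z.
  by rewrite (proj_adj (proj_pj B of_)) !aT Tf.
transitivity (\sum_(i in A) \sum_(j in B) ip (T (e i)) (f j) * ip (f j) (e i)).
  by apply: eq_bigr => i _; rewrite -ip_pj Tpj.
rewrite exchange_big; apply: eq_bigr => j _.
rewrite -Te aT ip_pj; apply: eq_bigr => i _.
by rewrite mulrC aT.
Qed.

Lemma sum_ip_QPQ (I J : finType) (A : {set I}) (e : I -> H) (B : {set J}) (f : J -> H) :
  orthonormal e -> orthonormal f ->
  \sum_(j in B) ip (pj B f (pj A e (pj B f (f j)))) (f j) = ptr A e B f.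
Proof.
move=> oe of_; rewrite /ptr exchange_big; apply: eq_bigr => j jB.
rewrite (proj_adj (proj_pj B of_)) !pj_on // jB ip_pj_pj //.
by apply: eq_bigr => i _; rewrite norm_ipC.
Qed.

Lemma unitary_inj W : h_unitary ip W -> injective W.
Proof.
move=> [lW iW _] x y Wxy; apply/eqP; rewrite -subr_eq0 -ip_eq0 -iW.
by rewrite (linear_sub lW) Wxy subrr ip0l.
Qed.

Lemma ptr_angle (I J I' J' : finType) (A : {set I}) (e : I -> H) (B : {set J}) (f : J -> H)
  (A' : {set I'}) (e' : I' -> H) (B' : {set J'}) (f' : J' -> H) :
  orthonormal e -> orthonormal f -> orthonormal e' -> orthonormal f' ->
  angle_eq ip (pj A' e') (pj B' f') (pj A e) (pj B f) ->
  ptr A' e' B' f' = ptr A e B f.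
Proof.
move=> oe of_ oe' of' [W [uW WT]]; have [lW iW sW] := uW.
have ipW := isometry_ip lW iW.
(* [W] carries [f'] to a second orthonormal system in which the trace of [T] can be computed. *)
have oWf : orthonormal (W \o f') by move=> i j; rewrite /= ipW.
have pP := proj_pj A oe; have pQ := proj_pj B of_.
rewrite -!sum_ip_QPQ //.
pose T := pj B f \o pj A e \o pj B f.
have -> : \sum_(j in B') ip (pj B' f' (pj A' e' (pj B' f' (f' j)))) (f' j) =
          \sum_(j in B') ip (T ((W \o f') j)) ((W \o f') j).
  by apply: eq_bigr => j _; rewrite -ipW WT.
apply: trace_indep => //.
- by move=> x y; rewrite /T /= (proj_adj pQ) (proj_adj pP) (proj_adj pQ).
- move=> x; have [y ->] := sW x; rewrite /T.
  have -> : pj B' (W \o f') (W y) = W (pj B' f' y).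
    rewrite {2}/pj (linear_sum _ _ lW); apply: eq_bigr => j _.
    by rewrite (linear_scale lW) ipW.
  by rewrite -!WT /= (proj_idem (proj_pj B' of')).
- by move=> x; rewrite /T /= (proj_idem pQ).
Qed.

Lemma proj_comp0 P Q x : is_projection ip P -> is_projection ip Q ->
  Q (P (Q x)) = 0 -> P (Q x) = 0.
Proof.
move=> pP pQ E; apply/eqP; rewrite -ip_eq0 (proj_ip pP) -(proj_idem pQ x).
by rewrite (proj_idem pQ) -(proj_adj pQ) E ip0l.
Qed.

(** Two projections commute if and only if [QPQ] is idempotent, and idempotency is invariant under
    unitary equivalence. *)
Lemma angle_comm P Q P' Q' : is_projection ip P -> is_projection ip Q ->
  is_projection ip P' -> is_projection ip Q' -> angle_eq ip P' Q' P Q ->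
  commuting P Q -> commuting P' Q'.
Proof.
move=> pP pQ pP' pQ' [W [uW WT]] cPQ.
pose T x := Q' (P' (Q' x)).
have TT x : T (T x) = T x.
  apply: (unitary_inj uW); have WT' y : W (T y) = Q (P (Q (W y))) by exact: WT.
  have E y : Q (P (Q y)) = P (Q y) by rewrite -cPQ (proj_idem pQ).
  by rewrite !WT' !E (proj_idem pP).
have QT x : Q' (T x) = T x by rewrite /T (proj_idem pQ').
have TQ x : T (Q' x) = T x by rewrite /T (proj_idem pQ').
have PT x : P' (T x) = T x.
  apply: proj_fixed => //.
  have <- : ip (T (T x)) (T x) = ip (P' (T x)) (T x); last by rewrite TT.
  by rewrite -[T (T x)]/(Q' (P' (Q' (T x)))) (proj_adj pQ') !QT.
(* The vector [x - T x] is killed by [T], hence by [P' Q']; and [P' Q'] fixes [T x]. *)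
have PQT x : P' (Q' x) = T x.
  have : Q' (P' (Q' (x - T x))) = 0.
    rewrite (linear_sub (proj_lin pQ')) (linear_sub (proj_lin pP')).
    by rewrite (linear_sub (proj_lin pQ')) -/(T x) -/(T (T x)) TT subrr.
  move/(proj_comp0 pP' pQ').
  rewrite (linear_sub (proj_lin pQ')) (linear_sub (proj_lin pP')) QT PT.
  by move/eqP; rewrite subr_eq0 => /eqP.
move=> x; rewrite PQT; apply: ip_injl => z.
by rewrite (proj_adj pQ') (proj_adj pP') PQT /T (proj_adj pQ') (proj_adj pP') (proj_adj pQ').
Qed.

Lemma angle_orth P Q P' Q' : is_projection ip P -> is_projection ip Q ->
  is_projection ip P' -> is_projection ip Q' -> angle_eq ip P' Q' P Q ->
  orth P Q -> orth P' Q'.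
Proof.
move=> pP pQ pP' pQ' [W [uW WT]] PQ x; apply: (proj_comp0 pP' pQ').
have [lW _ _] := uW; apply: (unitary_inj uW); rewrite [LHS]WT /= PQ.
by rewrite (linear0 (proj_lin pQ)) (linear0 lW).
Qed.

Lemma unitary_inv W : h_unitary ip W ->
  exists2 W', h_unitary ip W' & forall x, W' (W x) = x.
Proof.
move=> uW; have [lW iW sW] := uW; have injW := unitary_inj uW.
have [W' WW'] := choice sW; have W'W x : W' (W x) = x by apply: injW; rewrite -WW'.
exists W' => //; split.
- by move=> a x y; apply: injW; rewrite lW -!WW'.
- by move=> x; rewrite {3 4}(WW' x) iW.
- by move=> y; exists (W y).
Qed.

Lemma angle_sym P Q P' Q' : angle_eq ip P' Q' P Q -> angle_eq ip P Q P' Q'.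
Proof.
move=> [W [uW WT]]; have [W' uW' W'W] := unitary_inv uW; exists W'; split=> // x.
have [_ _ sW] := uW; have [y ->] := sW x.
by rewrite -WT !W'W.
Qed.

(** * Commuting projections *)

Section JointBasis.
Variables (J : finType) (n : nat) (Q : J -> H -> H).
Hypothesis rank_Q : forall j, proj_rank ip n (Q j).
Hypothesis comm_Q : forall i j, commuting (Q i) (Q j).

Let pQ j : is_projection ip (Q j). Proof. by case: (rank_Q j). Qed.

(** [w] arises from [z] by applying some of the [Q j]. The last clause records this: every property
    stable under all [Q j] passes from [z] to [w]. *)
Lemma joint_eigenvector (s : seq J) z : z != 0 ->
  exists w, [/\ w != 0, forall j, j \in s -> Q j w = 0 \/ Q j w = w &
    forall G : H -> Prop, (forall j y, G y -> G (Q j y)) -> G z -> G w].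
Proof.
move=> z0; elim: s => [|j s [w [w0 ws Gw]]]; first by exists z; split.
have [Qw0|Qw0] := eqVneq (Q j w) 0.
  exists w; split=> // i; rewrite inE => /orP[/eqP->|]; [by left | exact: ws].
exists (Q j w); split=> // [i|G GQ Gz]; last exact/GQ/(Gw G).
rewrite inE => /orP[/eqP->|/ws]; first by right; rewrite (proj_idem (pQ j)).
by rewrite comm_Q => -[] ->; [left; rewrite (linear0 (proj_lin (pQ j))) | right].
Qed.

(** The third condition keeps out vectors killed by all [Q j]; it bounds the size of such families
    even when [H] is infinite dimensional. *)
Definition eigen_family d (e : 'I_d -> H) :=
  [/\ orthonormal e, forall k j, Q j (e k) = 0 \/ Q j (e k) = e k &
      forall k, exists j, Q j (e k) = e k].

(** Estimate the sum of [ip (Q j (e k)) (e k)] twice: each [k] contributes at least 1, and each [j]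
    at most its rank [n] by Bessel. *)
Lemma eigen_family_le d (e : 'I_d -> H) : eigen_family e -> (d <= #|J| * n)%N.
Proof.
move=> [oe _ ex]; rewrite -(ler_nat K).
have le1 k : 1 <= \sum_j ip (Q j (e k)) (e k).
  have [j Qj] := ex k; rewrite (bigD1 j) //= Qj on_unit // lerDl.
  by apply: sumr_ge0 => i _; rewrite -(proj_ip (pQ i)) ip_ge0.
apply: (@le_trans _ _ (\sum_(k < d) \sum_j ip (Q j (e k)) (e k))).
  by rewrite -{1}(card_ord d) -sum1_card natr_sum; apply: ler_sum.
rewrite exchange_big /= natrM mulr_natl -sumr_const; apply: ler_sum => j _.
have [f of_ ->] := proj_rank_basis (rank_Q j).
under eq_bigr => k _ do rewrite ip_pj_pj //.
rewrite exchange_big /=.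
have -> : n%:R = \sum_(i in [set: 'I_n]) 1 :> K by rewrite sumr_const cardsT card_ord.
apply: ler_sum => i _.
have -> : 1 = ip (f i) (f i) by rewrite on_unit.
apply: le_trans (bessel [set: 'I_d] (f i) oe); rewrite le_eqVlt; apply/orP; left; apply/eqP.
by apply: eq_big => k; [rewrite inE | move=> _; rewrite norm_ipC].
Qed.

(* A maximal orthonormal family of joint eigenvectors exhausts every range. *)
Lemma joint_basis : exists d (e : 'I_d -> H) (F : J -> {set 'I_d}),
  orthonormal e /\ forall j, Q j = pj (F j) e.
Proof.
pose ok d := `[< exists e : 'I_d -> H, eigen_family e >].
have ex_ok : exists d, ok d by exists 0%N; apply/asboolP; exists (fun _ => 0); split; case.
have ok_le d : ok d -> (d <= #|J| * n)%N by move/asboolP => [e /eigen_family_le].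
case: (ex_maxnP ex_ok ok_le) => d /asboolP[e fe] max_d.
have [oe eig ex] := fe.
exists d, e, (fun j => [set k | `[< Q j (e k) = e k >]]); split=> // j.
set A := [set k | _]; have pA := proj_pj A oe.
have QA x : Q j (pj A e x) = pj A e x.
  by apply: pj_eq_fix => [|i]; [exact: proj_lin | rewrite inE => /asboolP].
(* A failure gives a nonzero vector in the range of [Q j] orthogonal to all [e k]; the joint
   eigenvector derived from it would enlarge the maximal family. *)
apply: proj_ext => // x; apply/eqP; rewrite -subr_eq0; apply/negPn/negP => z0.
have [w [w0 we Gw]] := joint_eigenvector (enum J) z0.
have [a a0 uu] := exists_unit w0.
have Qz : Q j (pj A e (Q j x) - Q j x) = pj A e (Q j x) - Q j x.
  by rewrite (linear_sub (proj_lin (pQ j))) QA (proj_idem (pQ j)).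
have Qw : Q j w = w.
  by apply: (Gw (fun y => Q j y = y)) => // i y Qy; rewrite comm_Q Qy.
have wk k : ip w (e k) = 0.
  apply: (Gw (fun y => forall k, ip y (e k) = 0)) => [i y Gy l|l].
    by rewrite (proj_adj (pQ i)); case: (eig l i) => ->; rewrite ?ip0r.
  have [lA|lA] := boolP (l \in A); first by rewrite ipBl ip_pj_on // lA subrr.
  rewrite -Qz (proj_adj (pQ j)); case: (eig l j) => [->|E]; first by rewrite ip0r.
  by rewrite inE in lA; move/asboolP: lA.
suff /max_d : ok d.+1 by rewrite ltnn.
apply/asboolP; exists (ocons (a *: w) e); split.
- by apply: on_ocons => // i; rewrite ipZl wk mulr0.
- move=> k i; case: (unliftP ord0 k) => [l|] ->; rewrite ?oconsS ?ocons0 //.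
  rewrite (linear_scale (proj_lin (pQ i))).
  by case: (we i); rewrite ?mem_enum // => ->; [left; rewrite scaler0 | right].
- move=> k; case: (unliftP ord0 k) => [l|] ->; rewrite ?oconsS ?ocons0 //.
  by exists j; rewrite (linear_scale (proj_lin (pQ j))) Qw.
Qed.

End JointBasis.

(** * Maps on projections of finite rank *)

Lemma ptr_same (I : finType) (A B : {set I}) (e : I -> H) : orthonormal e ->
  ptr A e B e = #|A :&: B|%:R.
Proof.
move=> oe; rewrite /ptr -sum1_card natr_sum [RHS](big_setID A) /=.
rewrite [X in _ = _ + X]big1 ?addr0; last by move=> i; rewrite !inE => /andP[/negPf->].
rewrite setIAC setIid big_mkcond [RHS]big_mkcond; apply: eq_bigr => i _; rewrite inE.
have [iA|//] := boolP (i \in A); have [iB|iB] := boolP (i \in B) => /=.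
  rewrite (bigD1 i) //= oe eqxx normr1 expr1n big1 ?addr0 // => j /andP[_ ji].
  by rewrite oe eq_sym (negPf ji) normr0 expr0n.
rewrite big1 // => j jB; rewrite oe; case: eqP => [ij|_]; last by rewrite normr0 expr0n.
by rewrite -ij (negPf iB) in jB.
Qed.

Lemma sum_delta (I : finType) (k : I) (c : K) (G : I -> K) :
  \sum_l c * (l == k)%:R * G l = c * G k.
Proof.
rewrite (bigD1 k) //= eqxx mulr1 big1 ?addr0 // => l /negPf->.
by rewrite mulr0 mul0r.
Qed.

(** The eigenvalue at [e l] of the diagonal operator [\sum_i a i *: pj (F i) e]. *)
Definition weight (I L : finType) (a : I -> K) (F : I -> {set L}) (l : L) : K :=
  \sum_i a i * (l \in F i)%:R.

(** The trace of a product of two linear combinations of projections, expanded by bilinearity on the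
    left and by eigenvalues on the right. *)
Lemma ptr_weighted (I J L M : finType) (a : I -> K) (b : J -> K)
    (F : I -> {set L}) (G : J -> {set M}) (e : L -> H) (f : M -> H) :
  \sum_i \sum_j a i * b j * ptr (F i) e (G j) f =
  \sum_l \sum_m weight a F l * weight b G m * `|ip (e l) (f m)| ^+ 2.
Proof.
transitivity (\sum_i \sum_j \sum_l \sum_m
    (a i * (l \in F i)%:R) * (b j * (m \in G j)%:R) * `|ip (e l) (f m)| ^+ 2).
  apply: eq_bigr => i _; apply: eq_bigr => j _.
  rewrite /ptr mulr_sumr big_mkcond; apply: eq_bigr => l _ /=.
  case: ifP => lF; last by rewrite big1 // => m _; rewrite mulr0 !mul0r.
  rewrite mulr_sumr big_mkcond; apply: eq_bigr => m _ /=.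
  by case: ifP => mG; rewrite ?mulr1 // !mulr0 mul0r.
rewrite [LHS](_ : _ = \sum_i \sum_l \sum_m \sum_j
    (a i * (l \in F i)%:R) * (b j * (m \in G j)%:R) * `|ip (e l) (f m)| ^+ 2); last first.
  apply: eq_bigr => i _; rewrite exchange_big; apply: eq_bigr => l _.
  by rewrite exchange_big.
rewrite exchange_big; apply: eq_bigr => l _; rewrite exchange_big; apply: eq_bigr => m _.
under eq_bigr => i _ do rewrite -mulr_suml -mulr_sumr.
by rewrite -!mulr_suml.
Qed.

Lemma dim_ge_orth_unit m (l : seq H) : dim_ge H m -> (size l < m)%N ->
  exists u, [/\ True, ip u u = 1 & forall y, y \in l -> ip u y = 0].
Proof.
move=> [w iw] /(exists_orth_unit iw)[u [c [_ uu ul]]]; by exists u.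
Qed.

Lemma on_dim_ge m d (e : 'I_d -> H) : orthonormal e -> (m <= d)%N -> dim_ge H m.
Proof.
move=> oe md; exists (e \o widen_ord md); apply: on_lin_indep => i j.
by rewrite /= oe; congr (_%:R); rewrite -!val_eqE.
Qed.

Section FiniteRank.
Variables (n : nat) (phi : (H -> H) -> (H -> H)).
Hypothesis phi_rank : forall P, proj_rank ip n P -> proj_rank ip n (phi P).
Hypothesis phi_angle : forall P Q, proj_rank ip n P -> proj_rank ip n Q ->
  angle_eq ip (phi P) (phi Q) P Q.

Lemma phi_ptr (I J I' J' : finType) (A : {set I}) (e : I -> H) (B : {set J}) (f : J -> H)
  (A' : {set I'}) (e' : I' -> H) (B' : {set J'}) (f' : J' -> H) :
  orthonormal e -> orthonormal f -> orthonormal e' -> orthonormal f' ->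
  #|A| = n -> #|B| = n -> phi (pj A e) = pj A' e' -> phi (pj B f) = pj B' f' ->
  ptr A' e' B' f' = ptr A e B f.
Proof.
move=> oe of_ oe' of' cA cB eA eB; apply: ptr_angle => //; rewrite -eA -eB.
by apply: phi_angle; [rewrite -cA | rewrite -cB]; exact: proj_rank_pj.
Qed.

(** [pj [set~ i] X] is the coordinate projection omitting [X i]; [e] is a joint eigenbasis of the
    images of all of them. *)
Definition frame (X : 'I_n.+1 -> H) d (e : 'I_d -> H) (F : 'I_n.+1 -> {set 'I_d}) :=
  [/\ orthonormal X, orthonormal e & forall i, phi (pj [set~ i] X) = pj (F i) e].

Lemma card_coord (i : 'I_n.+1) : #|[set~ i]| = n.
Proof. by have := cardsC1 i; rewrite card_ord. Qed.

Lemma exists_frame X : orthonormal X -> exists d (e : 'I_d -> H) F, frame X e F.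
Proof.
move=> oX.
have rX i : proj_rank ip n (pj [set~ i] X) by rewrite -{1}(card_coord i); exact: proj_rank_pj.
have [||d [e [F [oe eF]]]] := @joint_basis _ n (fun i => phi (pj [set~ i] X)).
- by move=> i; apply: phi_rank.
- move=> i j; apply: angle_comm (phi_angle (rX i) (rX j)) _.
  1-2: by case: (rX i); case: (rX j).
  1-2: by case: (phi_rank (rX i)); case: (phi_rank (rX j)).
  move=> x; rewrite {2 4}/pj !(linear_sum _ _ (@pj_linear _ _ _)).
  rewrite big_mkcond [RHS]big_mkcond; apply: eq_bigr => k _.
  rewrite !(linear_scale (@pj_linear _ _ _)) !pj_on //.
  by case: (k \in _); case: (k \in _); rewrite ?scaler0.
by exists d, e, F.
Qed.

Lemma frame_ptr X d (e : 'I_d -> H) F Y d' (f : 'I_d' -> H) G i j :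
  frame X e F -> frame Y f G -> ptr (F i) e (G j) f = ptr [set~ i] X [set~ j] Y.
Proof.
by move=> [oX oe eF] [oY of_ fG]; apply: phi_ptr; rewrite ?card_coord.
Qed.

Lemma frame_cardI X d (e : 'I_d -> H) F i j : frame X e F ->
  #|F i :&: F j| = #|[set~ i] :&: [set~ j]|.
Proof.
move=> fr; have [oX oe _] := fr; have := frame_ptr i j fr fr; rewrite !ptr_same //.
by move/eqP; rewrite eqr_nat => /eqP.
Qed.

Lemma frame_card X d (e : 'I_d -> H) F i : frame X e F -> #|F i| = n.
Proof. by move=> fr; rewrite -(setIid (F i)) (frame_cardI i i fr) setIid card_coord. Qed.

Lemma frame_cardD X d (e : 'I_d -> H) F i j : frame X e F -> i != j ->
  #|F i :&: F j| = n.-1.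
Proof.
move=> fr ij; rewrite (frame_cardI i j fr) -setCU cardsCs setCK card_ord.
by rewrite cards2 ij subSS subn1.
Qed.

(* With these coefficients [\sum_i coef i *: pj [set~ i] X] is [n] times the
   projection onto the line of [X ord0]. *)
Definition coef (i : 'I_n.+1) : K := 1 - n%:R * (i == ord0)%:R.

Lemma weight_coef d (F : 'I_n.+1 -> {set 'I_d}) l :
  weight coef F l = (\sum_i (l \in F i))%:R - n%:R * (l \in F ord0)%:R.
Proof.
rewrite /weight natr_sum (eq_bigr (fun i => (l \in F i)%:R - n%:R * (i == ord0)%:R * (l \in
  F i)%:R)).
  by rewrite big_split /= sumrN sum_delta.
by move=> i _; rewrite /coef mulrDl mul1r mulNr.
Qed.

Lemma weight_coord (l : 'I_n.+1) : weight coef (fun i => [set~ i]) l = n%:R * (l == ord0)%:R.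
Proof.
rewrite weight_coef.
have -> : (\sum_(i < n.+1) (l \in [set~ i]) = n)%N.
  rewrite (bigD1 l) //= !inE eqxx add0n (eq_bigr (fun _ => 1%N)); last first.
    by move=> i il; rewrite !inE eq_sym il.
  by rewrite sum1_card cardC1 card_ord.
by rewrite !inE; case: (l == ord0); rewrite ?mulr0 ?mulr1 ?subr0 ?subrr.
Qed.

(** The right side is the trace of the product of [n] times the line of [X ord0] and [n] times the
    line of [Y ord0]; the left side is the same combination of traces after [phi]. *)
Lemma frame_pairing X d (e : 'I_d -> H) F Y d' (f : 'I_d' -> H) G :
  frame X e F -> frame Y f G ->
  \sum_l \sum_m weight coef F l * weight coef G m * `|ip (e l) (f m)| ^+ 2 =
  n%:R * (n%:R * `|ip (X ord0) (Y ord0)| ^+ 2).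
Proof.
move=> frX frY; rewrite -ptr_weighted.
transitivity (\sum_i \sum_j coef i * coef j * ptr [set~ i] X [set~ j] Y).
  by apply: eq_bigr => i _; apply: eq_bigr => j _; rewrite (frame_ptr i j frX frY).
rewrite (ptr_weighted coef coef (fun i => [set~ i]) (fun i => [set~ i])).
under eq_bigr => l _ do under eq_bigr => m _ do rewrite !weight_coord -mulrA.
under eq_bigr => l _ do rewrite -mulr_sumr sum_delta.
by rewrite sum_delta.
Qed.

Lemma frame_proj X d (e : 'I_d -> H) F P : frame X e F -> proj_rank ip n P ->
  \sum_l weight coef F l * ip (phi P (e l)) (e l) = n%:R * ip (P (X ord0)) (X ord0).
Proof.
move=> [oX oe eF] rP.
have [f of_ eP] := proj_rank_basis rP.
have [f' of' eP'] := proj_rank_basis (phi_rank rP).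
have cT : #|[set: 'I_n]| = n by rewrite cardsT card_ord.
(* A single projection seen as a combination with one term, so that [ptr_weighted] applies. *)
pose one (_ : 'I_1) := 1 : K; pose S (_ : 'I_1) := [set: 'I_n].
have w1 m : weight one S m = 1 by rewrite /weight big_ord1 inE mulr1.
have gen d1 (e1 : 'I_d1 -> H) F1 (g : 'I_n -> H) : orthonormal g ->
    \sum_l weight coef F1 l * ip (pj setT g (e1 l)) (e1 l) =
    \sum_i \sum_(j < 1) coef i * one j * ptr (F1 i) e1 (S j) g.
  move=> og; rewrite ptr_weighted; apply: eq_bigr => l _.
  rewrite ip_pj_pj // mulr_sumr; apply: eq_big => m; first by rewrite inE.
  by rewrite w1 mulr1.
rewrite eP' gen //.
transitivity (\sum_i \sum_(j < 1) coef i * one j * ptr [set~ i] X (S j) f).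
  apply: eq_bigr => i _; apply: eq_bigr => j _; congr (_ * _).
  by apply: phi_ptr; rewrite ?card_coord // -eP.
rewrite -gen //; under eq_bigr => l _ do rewrite weight_coord.
by rewrite sum_delta -eP.
Qed.

(** Dimension [2n + 1] leaves room for a second system [Y] that shares [X ord0] and is otherwise
    orthogonal to [X]. The pairing of the two systems should be [n^2], but the star shape of [F]
    bounds it by [n]. *)
Lemma frame_star_dim X d (e : 'I_d -> H) F : frame X e F -> (1 < n)%N ->
  (forall l, l \notin F ord0 -> (\sum_i (l \in F i) <= 1)%N) -> ~ dim_ge H (n + n).+1.
Proof.
move=> frX n1 star dimH; have [oX oe eF] := frX.
have [||f [of_ _ fX]] := @exists_on (fun _ => True) (n + n).+1 _ n (codom X).
- by move=> l; apply: dim_ge_orth_unit.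
- by rewrite size_codom card_ord; lia.
have fX' i j : ip (f i) (X j) = 0 by apply: fX; exact: codom_f.
pose Y := ocons (X ord0) f.
have oY : orthonormal Y.
  by apply: (on_ocons (on_unit ord0 oX) of_) => i; apply: ip_sym0.
have [d' [g [G frY]]] := exists_frame oY.
have [_ og eG] := frY.
(* The projection omitting [Y ord0] is orthogonal to all of [X]. The preserved trace is 0, and it is
   a sum of nonnegative terms. *)
have t0 i l m : l \in F i -> m \in G ord0 -> `|ip (e l) (g m)| ^+ 2 = 0.
  move=> lF mG; have : ptr (F i) e (G ord0) g = 0.
    rewrite (frame_ptr i ord0 frX frY) /ptr big1 // => k _; rewrite big1 // => j.
    rewrite !inE; case: (unliftP ord0 j) => [j'|] -> //= _.
    by rewrite /Y oconsS (ip_sym0 (fX' _ _)) normr0 expr0n.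
  move/eqP; rewrite psumr_eq0 => [|k _]; last by apply: sumr_ge0 => *; rewrite exprn_ge0.
  move/allP/(_ l); rewrite mem_index_enum lF => /(_ isT)/=.
  rewrite psumr_eq0 => [|k _]; last by rewrite exprn_ge0.
  by move/allP/(_ m); rewrite mem_index_enum mG => /(_ isT)/eqP.
have := frame_pairing frX frY; rewrite /Y ocons0 on_unit // normr1 expr1n mulr1.
have n0 : (0 < n)%N by lia.
suff le_n : \sum_l \sum_m weight coef F l * weight coef G m * `|ip (e l) (g m)| ^+ 2 <= n%:R.
  move=> E; rewrite E -natrM ler_nat in le_n; by move: le_n n1; clear; nia.
rewrite exchange_big /= (bigID (fun m => m \in G ord0)) /= big1 ?add0r => [|m mG]; last first.
  rewrite big1 // => l _.
  have [/existsP[i lF]|/existsPn no] := boolP [exists i, l \in F i].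
    by rewrite (t0 i l m) ?mulr0.
  rewrite weight_coef (negPf (no ord0)) big1 ?mulr0 ?subrr ?mul0r // => i _.
  by rewrite (negPf (no i)).
(* Only [m] outside [G ord0] remain. Their weights add up to [n], so it suffices to bound each inner
   sum over [l] by 1. *)
rewrite -[X in _ <= X%:R](sum_mem_family_off n0 (fun i => frame_card i frY) (fun i j =>
  frame_cardD frY)).
rewrite natr_sum; apply: ler_sum => m mG.
rewrite [weight coef G m]weight_coef (negPf mG) mulr0 subr0.
set c := (_)%:R; under eq_bigr => l _ do rewrite mulrAC mulrC.
rewrite -mulr_sumr -[X in _ <= X]mulr1; apply: ler_wpM2l; first by rewrite ler0n.
apply: le_trans (_ : ip (g m) (g m) <= _); last by rewrite on_unit.
apply: le_trans (bessel [set: 'I_d] (g m) oe).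
rewrite [X in _ <= X](eq_bigl predT); last by move=> l; rewrite inE.
apply: ler_sum => l _; rewrite norm_ipC -[X in _ <= X]mul1r.
apply: ler_wpM2r; first by rewrite exprn_ge0.
(* Every weight of [F] is at most 1: on [F ord0] it is at most [(n + 1) - n], and elsewhere the star
   hypothesis applies. Bessel does the rest. *)
rewrite weight_coef lerBlDr; have [l0|l0] := boolP (l \in F ord0).
  rewrite mulr1 -(natrD _ 1) ler_nat; apply: leq_trans (_ : \sum_(i < n.+1) 1 <= _)%N.
    by apply: leq_sum => i _; case: (l \in F i).
  by rewrite sum1_card card_ord.
by rewrite mulr0 addr0 (ler_nat K _ 1) star.
Qed.

(** The combination of the images is [n] times a line. The star alternative is excluded by
    [frame_star_dim] above dimension [2n] and by [family_star_dim] below it. *)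
Lemma frame_atom X d (e : 'I_d -> H) F : frame X e F -> (0 < n)%N ->
  n = 1%N \/ (dim_ge H (n + n).+1 \/ ~ dim_ge H (n + n)) ->
  exists k, forall l, weight coef F l = n%:R * (l == k)%:R.
Proof.
move=> frX n0 dimH; have [oX oe eF] := frX.
have card_F := fun i => frame_card i frX.
have card_FI := fun i j => @frame_cardD _ _ _ _ i j frX.
have [n1|n1] := eqVneq n 1%N.
  (* For [n = 1] the coefficients are 0 and 1, and what survives is the image of the projection
     omitting [X ord_max], the line of [X ord0] itself. *)
  have [k Fk] : exists k, F ord_max = [set k] by apply/cards1P; rewrite card_F n1.
  have n1K : n%:R = 1 :> K by rewrite n1.
  exists k => l; rewrite weight_coef n1K !mul1r.
  have -> : (\sum_i (l \in F i) = (l \in F ord0) + (l \in F ord_max))%N.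
    rewrite (bigD1 (ord0 : 'I_n.+1)) //= (bigD1 (ord_max : 'I_n.+1)) /=; last first.
      by rewrite -val_eqE /= n1.
    rewrite big1 ?addn0 // => i /andP[]; rewrite -!val_eqE /=.
    by have := ltn_ord i; move: n1; lia.
  by rewrite natrD addrC addKr Fk inE.
have [[k Ek]|star] := family_dichotomy n0 card_F card_FI.
  exists k => l; rewrite weight_coef Ek natrM natrD; ring.
exfalso; have n_gt1 : (1 < n)%N by lia.
case: dimH => [/eqP|[dimH|dimH]]; first by rewrite (negPf n1).
  exact: (frame_star_dim frX).
apply: dimH; exact: on_dim_ge (family_star_dim n0 card_F card_FI star).
Qed.

Lemma finite_lines : (0 < n)%N -> dim_ge H n.+1 ->
  n = 1%N \/ (dim_ge H (n + n).+1 \/ ~ dim_ge H (n + n)) ->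
  exists chi : H -> H,
    (forall x y, ip x x = 1 -> ip y y = 1 -> `|ip (chi x) (chi y)| = `|ip x y|) /\
    (forall P x, proj_rank ip n P -> ip x x = 1 ->
       ip (chi x) (chi x) = 1 /\ ip (phi P (chi x)) (chi x) = ip (P x) x).
Proof.
move=> n0 dimS dimH.
have nz : n%:R != 0 :> K by rewrite pnatr_eq0; lia.
pose line x u := exists X d (e : 'I_d -> H) F k,
  [/\ frame X e F, X ord0 = x, u = e k & forall l, weight coef F l = n%:R * (l == k)%:R].
have ex_line x : exists u, ip x x = 1 -> line x u.
  (* The value 0 off the unit sphere is a dummy. *)
  have [xx|nxx] := pselect (ip x x = 1); last by exists 0.
  have [||f [of_ _ fx]] := @exists_on (fun _ => True) n.+1 _ n [:: x].
  - by move=> l; apply: dim_ge_orth_unit.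
  - by rewrite /= add1n.
  have oX : orthonormal (ocons x f).
    apply: on_ocons => // i; apply: ip_sym0; apply: fx; exact: mem_head.
  have [d [e [F fr]]] := exists_frame oX.
  have [k wk] := frame_atom fr n0 dimH.
  exists (e k) => _; exists (ocons x f), d, e, F, k; split=> //; exact: ocons0.
have [chi chiP] := choice ex_line; exists chi; split.
  move=> x y /chiP[X [d [e [F [k [frX <- -> wF]]]]]] /chiP[Y [d' [g [G [m [frY <- -> wG]]]]]].
  have := frame_pairing frX frY.
  under eq_bigr => l _ do under eq_bigr => j _ do rewrite wF wG -mulrA.
  under eq_bigr => l _ do rewrite -mulr_sumr sum_delta.
  rewrite sum_delta => /(mulfI nz)/(mulfI nz)/eqP.
  by rewrite eqrXn2 // => /eqP.
move=> P x rP /chiP[X [d [e [F [k [frX <- -> wF]]]]]].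
have [oX oe _] := frX; split; first exact: (on_unit _ oe).
have := frame_proj frX rP; under eq_bigr => l _ do rewrite wF.
by rewrite sum_delta => /(mulfI nz).
Qed.

End FiniteRank.

(** * Wigner's theorem *)

Lemma cauchy_schwarz_eq u v : v != 0 -> `|ip u v| ^+ 2 = ip u u * ip v v ->
  u = (ip u v / ip v v) *: v.
Proof.
move=> v0 E; have vv : ip v v != 0 by rewrite ip_eq0.
apply/eqP; rewrite -subr_eq0 -ip_eq0 !(ipBl, ipBr, ipZl, ipZr) (conjM cK).
rewrite -ipC (conj_nneg cK (a := (ip v v)^-1)) ?invr_ge0 ?ip_ge0 //.
apply/eqP; move: E; rewrite sqr_norm_ip => E.
transitivity (ip u u - ip u v * ip v u / ip v v); first by field.
by rewrite E mulfK ?subrr.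
Qed.

(** Doubling makes inner products occur only in symmetric sums [ip p q + ip q p], twice the real
    part, which is all that is known to be preserved in [wigner_S_re]. *)
Lemma real_form_expand a p q r : conj a = a ->
  2 * ip (p - a *: q - r) (p - a *: q - r) =
  (ip p p + ip p p) - 2 * a * (ip p q + ip q p) - 2 * (ip p r + ip r p) +
  a ^+ 2 * (ip q q + ip q q) + 2 * a * (ip q r + ip r q) + (ip r r + ip r r).
Proof. by move=> ca; rewrite !(ipBl, ipBr, ipZl, ipZr) ca; ring. Qed.

Definition field_aut (s : K -> K) := s = id \/ s = conj.

Lemma field_autD s : field_aut s -> {morph s : a b / a + b}.
Proof. by case=> -> // a b; rewrite (conjD cK). Qed.

Lemma field_autM s : field_aut s -> {morph s : a b / a * b}.
Proof. by case=> -> // a b; rewrite (conjM cK). Qed.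

Lemma norm_field_aut s a : field_aut s -> `|s a| = `|a|.
Proof. by case=> -> //; rewrite norm_conj. Qed.

Lemma field_aut_conj s a : field_aut s -> s (conj a) = conj (s a).
Proof. by case=> ->. Qed.

Lemma field_autK s : field_aut s -> involutive s.
Proof. by case=> -> //; exact: conjK. Qed.

Lemma field_aut1 s : field_aut s -> s 1 = 1.
Proof. by case=> ->; rewrite ?conj1. Qed.

Lemma field_aut0 s : field_aut s -> s 0 = 0.
Proof. by case=> ->; rewrite ?conj0. Qed.

Lemma field_aut_real s a : field_aut s -> conj a = a -> s a = a.
Proof. by case=> ->. Qed.

Section Wigner.
Variable T : H -> H.
Hypothesis T_abs : forall x y, `|ip (T x) (T y)| = `|ip x y|.
Variable e : H.
Hypothesis e_unit : ip e e = 1.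

Lemma wigner_norm x : ip (T x) (T x) = ip x x.
Proof. by rewrite -[LHS]ger0_norm ?ip_ge0 // T_abs ger0_norm ?ip_ge0. Qed.

Lemma wigner_scale a x : a != 0 -> exists c, T (a *: x) = c *: T x.
Proof.
move=> a0; have [->|x0] := eqVneq x 0; first by rewrite scaler0; exists 1; rewrite scale1r.
have Tx0 : T x != 0 by rewrite -ip_eq0 wigner_norm ip_eq0.
exists (ip (T (a *: x)) (T x) / ip (T x) (T x)); apply: cauchy_schwarz_eq => //.
rewrite T_abs !wigner_norm sqr_norm_ip !(ipZl, ipZr); ring.
Qed.

(* [T e + S z] is the representative of the ray of [e + z] whose component
   along [T e] is [T e] itself. *)
Lemma exists_wigner_S : exists S : H -> H, forall z, ip z e = 0 ->
  ip (S z) (T e) = 0 /\ exists2 c, `|c| = 1 & T e + S z = c *: T (e + z).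
Proof.
suff /choice[S SP] : forall z, exists v, ip z e = 0 ->
    ip v (T e) = 0 /\ exists2 c, `|c| = 1 & T e + v = c *: T (e + z) by exists S.
move=> z; exists ((ip (T (e + z)) (T e))^-1 *: T (e + z) - T e) => ze.
have lam1 : `|ip (T (e + z)) (T e)| = 1 by rewrite T_abs ipDl ze addr0 e_unit normr1.
have lam0 : ip (T (e + z)) (T e) != 0 by rewrite -normr_eq0 lam1 oner_eq0.
split; first by rewrite ipBl ipZl mulVf // wigner_norm e_unit subrr.
exists (ip (T (e + z)) (T e))^-1; first by rewrite normfV lam1 invr1.
by rewrite addrC subrK.
Qed.

Variable S : H -> H.
Hypothesis S_orth : forall z, ip z e = 0 -> ip (S z) (T e) = 0.
Hypothesis S_def : forall z, ip z e = 0 -> exists2 c, `|c| = 1 & T e + S z = c *: T (e + z).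

Lemma wigner_S_shift z w : ip z e = 0 -> ip w e = 0 ->
  `|1 + ip (S z) (S w)| = `|1 + ip z w|.
Proof.
move=> ze we.
have -> : 1 + ip (S z) (S w) = ip (T e + S z) (T e + S w).
  rewrite !(ipDl, ipDr) wigner_norm e_unit S_orth // (ip_sym0 (S_orth we)); ring.
have [c c1 ->] := S_def ze; have [d d1 ->] := S_def we.
rewrite ipZl ipZr !normrM norm_conj c1 d1 !mul1r T_abs.
by rewrite !(ipDl, ipDr) e_unit ze (ip_sym0 we) addr0 add0r.
Qed.

Lemma wigner_S_norm z : ip z e = 0 -> ip (S z) (S z) = ip z z.
Proof.
move=> ze; have := wigner_S_shift ze ze; rewrite !ger0_norm ?addr_ge0 ?ip_ge0 //.
by move/addrI.
Qed.

(** [T z] is orthogonal to [T e], so its product with [S z] equals that with [T e + S z], whose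
    modulus is [ip z z]: equality in Cauchy-Schwarz. *)
Lemma wigner_S_ray z : ip z e = 0 -> exists2 c, `|c| = 1 & S z = c *: T z.
Proof.
move=> ze; have [z0|z0] := eqVneq z 0.
  exists 1; first by rewrite normr1.
  apply/eqP; rewrite scale1r; have /eqP := wigner_S_norm ze; rewrite z0 ip0l ip_eq0 => /eqP->.
  by have /eqP := wigner_norm 0; rewrite ip0l ip_eq0 eq_sym.
have zz : ip z z != 0 by rewrite ip_eq0.
have Tz0 : T z != 0 by rewrite -ip_eq0 wigner_norm ip_eq0.
have E : `|ip (S z) (T z)| = ip z z.
  have -> : ip (S z) (T z) = ip (T e + S z) (T z).
    rewrite ipDl; have -> : ip (T e) (T z) = 0; last by rewrite add0r.
    by apply/eqP; rewrite -normr_eq0 T_abs (ip_sym0 ze) normr0.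
  have [c c1 ->] := S_def ze.
  rewrite ipZl normrM c1 mul1r T_abs ipDl (ip_sym0 ze) add0r.
  by rewrite ger0_norm ?ip_ge0.
exists (ip (S z) (T z) / ip (T z) (T z)).
  by rewrite normrM normfV E wigner_norm ger0_norm ?ip_ge0 // divff.
by apply: cauchy_schwarz_eq => //; rewrite E wigner_norm wigner_S_norm // expr2.
Qed.

Lemma wigner_S_abs z w : ip z e = 0 -> ip w e = 0 -> `|ip (S z) (S w)| = `|ip z w|.
Proof.
move=> /wigner_S_ray[c c1 ->] /wigner_S_ray[d d1 ->].
by rewrite ipZl ipZr !normrM norm_conj c1 d1 !mul1r T_abs.
Qed.

(** The moduli of [c] and of [1 + c] determine the real part of [c]. *)
Lemma wigner_S_re z w : ip z e = 0 -> ip w e = 0 ->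
  ip (S z) (S w) + ip (S w) (S z) = ip z w + ip w z.
Proof.
move=> ze we; have := congr1 (fun c => c ^+ 2) (wigner_S_shift ze we).
rewrite -!(mul_conj cK) !(conjD cK) conj1 -!ipC.
have := congr1 (fun c => c ^+ 2) (wigner_S_abs ze we); rewrite !sqr_norm_ip => E F.
apply: (addrI 1); apply: (addIr (ip z w * ip w z)); rewrite -{1}E.
transitivity ((1 + ip (S z) (S w)) * (1 + ip (S w) (S z))); first by ring.
by rewrite F; ring.
Qed.

(** The squared norm of the defect involves only real parts, so it equals that of
    [(a *: z + w) - a *: z - w]. *)
Lemma wigner_S_real_linear a z w : conj a = a -> ip z e = 0 -> ip w e = 0 ->
  S (a *: z + w) = a *: S z + S w.
Proof.
move=> ca ze we; have ue : ip (a *: z + w) e = 0 by rewrite ipDl ipZl ze we mulr0 addr0.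
apply/eqP; rewrite -subr_eq0 opprD addrA -ip_eq0.
have two0 : 2 != 0 :> K by rewrite pnatr_eq0.
rewrite -(inj_eq (mulfI two0)) mulr0 real_form_expand // !wigner_S_re //.
by rewrite -real_form_expand // -addrA -opprD subrr ip0l mulr0.
Qed.

Lemma wigner_S_add z w : ip z e = 0 -> ip w e = 0 -> S (z + w) = S z + S w.
Proof. by move=> ze we; have := wigner_S_real_linear conj1 ze we; rewrite !scale1r. Qed.

Lemma wigner_S0 : S 0 = 0.
Proof. by apply/eqP; rewrite -ip_eq0 wigner_S_norm ip0l. Qed.

Lemma wigner_S_real_scale a z : conj a = a -> ip z e = 0 -> S (a *: z) = a *: S z.
Proof.
move=> ca ze; have := wigner_S_real_linear ca ze (ip0l e).
by rewrite wigner_S0 !addr0.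
Qed.

(** The product of [S (j *: z)] with [S z] is purely imaginary of modulus [ip z z], which leaves two
    values. *)
Lemma wigner_S_imag j z : j * j = -1 -> conj j = - j -> ip z e = 0 ->
  S (j *: z) = j *: S z \/ S (j *: z) = - j *: S z.
Proof.
move=> jj cj ze; have [->|z0] := eqVneq z 0.
  by left; rewrite scaler0 wigner_S0 scaler0.
have jze : ip (j *: z) e = 0 by rewrite ipZl ze mulr0.
have zz : ip z z != 0 by rewrite ip_eq0.
have Sz0 : S z != 0 by rewrite -ip_eq0 wigner_S_norm // ip_eq0.
have j1 : `|j| = 1.
  by apply/eqP; rewrite -(eqrXn2 (n := 2)) // -(mul_conj cK) cj mulrN jj opprK expr1n.
set s := ip (S (j *: z)) (S z).
have sabs : `|s| = ip z z.
  by rewrite /s wigner_S_abs // ipZl normrM j1 mul1r ger0_norm ?ip_ge0.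
have sN : conj s = - s.
  apply/eqP; rewrite -addr_eq0 addrC /s -ipC wigner_S_re // ipZl ipZr cj; apply/eqP; ring.
have Ss : S (j *: z) = (s / ip z z) *: S z.
  rewrite -(wigner_S_norm ze); apply: cauchy_schwarz_eq => //.
  rewrite -/s sabs !wigner_S_norm // ipZl ipZr cj mulrA mulrN jj opprK mul1r expr2 //.
have : (s - j * ip z z) * (s + j * ip z z) = 0.
  have := mul_conj cK s; rewrite sN sabs => E.
  transitivity (- (s * - s) - j * j * ip z z ^+ 2); first by ring.
  by rewrite E jj; ring.
move/eqP; rewrite mulf_eq0 subr_eq0 addr_eq0 => /orP[]/eqP E; [left|right].
  by rewrite Ss E mulfK.
by rewrite Ss E -mulNr mulfK.
Qed.

Lemma wigner_S_semilinear : exists2 s, field_aut s &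
  forall a z, ip z e = 0 -> S (a *: z) = s a *: S z.
Proof.
case: (real_or_complex cK) => [re|[j [jj cj dec]]].
  by exists id => [|a z ze]; [left | rewrite wigner_S_real_scale].
have scal s : (forall z, ip z e = 0 -> S (j *: z) = s *: S z) -> 
    forall p q z, conj p = p -> conj q = q -> ip z e = 0 ->
    S ((p + q * j) *: z) = (p + q * s) *: S z.
  move=> Ss p q z cp cq ze; have jze : ip (j *: z) e = 0 by rewrite ipZl ze mulr0.
  have qje : ip (q *: (j *: z)) e = 0 by rewrite ipZl jze mulr0.
  rewrite scalerDl -scalerA (wigner_S_real_linear cp ze qje).
  by rewrite (wigner_S_real_scale cq jze) Ss // scalerDl scalerA.
have [lin|/existsNP nlin] := pselect (forall z, ip z e = 0 -> S (j *: z) = j *: S z).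
  exists id => [|a z ze]; first by left.
  by have [p [q [cp cq ->]]] := dec a; rewrite (scal _ lin).
have [z /not_implyP[ze nz]] := nlin.
have Sz : S (j *: z) = - j *: S z by case: (wigner_S_imag jj cj ze).
exists conj => [|a w we]; first by right.
have [p [q [cp cq ->]]] := dec a; rewrite (conjD cK) (conjM cK) cp cq cj.
apply: scal => // {a w we p q cp cq} w we.
case: (wigner_S_imag jj cj we) => // Sw.
have je y : ip y e = 0 -> ip (j *: y) e = 0 by move=> ye; rewrite ipZl ye mulr0.
have zwe : ip (z + w) e = 0 by rewrite ipDl ze we addr0.
have : S (j *: (z + w)) = - j *: S z + j *: S w.
  by rewrite scalerDr wigner_S_add ?je // Sz Sw.
have j0 : j != 0 by apply: contra_eq_neq jj => ->; rewrite mul0r eq_sym oppr_eq0 oner_eq0.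
have opp0 (v : H) : - j *: v = j *: v -> v = 0.
  move/eqP; rewrite scaleNr eq_sym -subr_eq0 opprK -mulr2n -scaler_nat scalerA scaler_eq0.
  by rewrite mulf_eq0 pnatr_eq0 (negPf j0) /= => /eqP.
(* The sign is the same for all vectors: if [z] has sign minus and [w] plus, either sign for [z + w]
   makes [S z] or [S w] vanish. The first contradicts the choice of [z], and in the second both
   signs hold for [w]. *)
case: (wigner_S_imag jj cj zwe) => ->; rewrite wigner_S_add // scalerDr.
  by move/addIr/esym/opp0 => Sz0; case: nz; rewrite Sz Sz0 !scaler0.
by move/addrI/opp0 => Sw0; rewrite Sw Sw0 !scaler0.
Qed.

End Wigner.

Lemma exists_norm : exists N : H -> K, forall x, 0 <= N x /\ N x ^+ 2 = ip x x.
Proof.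
have /choice[N NP] x : exists r : K, 0 <= r /\ r ^+ 2 = ip x x.
  by have [r r0 rr] := exists_sqrt cK (ip_ge0 x); exists r.
by exists N.
Qed.

Lemma wigner (chi : H -> H) :
  (forall x y, ip x x = 1 -> ip y y = 1 -> `|ip (chi x) (chi y)| = `|ip x y|) ->
  exists V s, [/\ is_isometry ip V, field_aut s,
    forall a x y, V (a *: x + y) = s a *: V x + V y &
    forall x, ip x x = 1 -> exists c, V x = c *: chi x].
Proof.
move=> chiP.
have [[e ee]|noe] := pselect (exists e, ip e e = 1); last first.
  exists id, id; split=> //; first by left.
  by move=> x xx; case: noe; exists x.
have [N NP] := exists_norm.
have N1 x : ip x x = 1 -> N x = 1.
  move=> xx; have [N0 NN] := NP x; apply/eqP; rewrite -(eqrXn2 (n := 2)) //.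
  by rewrite NN xx expr1n.
have Nu x : N x != 0 -> ip ((N x)^-1 *: x) ((N x)^-1 *: x) = 1.
  move=> Nx; have [N0 NN] := NP x.
  by rewrite ipZl ipZr (conj_nneg cK) ?invr_ge0 // -NN mulrA; field.
(* The homogeneous extension of [chi] from the unit sphere preserves the moduli of all inner
   products. *)
pose T x := N x *: chi ((N x)^-1 *: x).
have Tunit x : ip x x = 1 -> T x = chi x by move=> xx; rewrite /T N1 // invr1 !scale1r.
have T_abs x y : `|ip (T x) (T y)| = `|ip x y|.
  rewrite /T ipZl ipZr (conj_nneg cK) ?(NP y).1 // !normrM.
  have [x0|x0] := eqVneq (N x) 0.
    have /eqP := (NP x).2; rewrite x0 expr0n eq_sym ip_eq0 => /eqP ->.
    by rewrite normr0 mul0r ip0l normr0.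
  have [y0|y0] := eqVneq (N y) 0.
    have /eqP := (NP y).2; rewrite y0 expr0n eq_sym ip_eq0 => /eqP ->.
    by rewrite normr0 mul0r mulr0 ip0r normr0.
  rewrite chiP ?Nu // -!normrM ipZl ipZr (conj_nneg cK) ?invr_ge0 ?(NP y).1 //.
  by congr `|_|; field; rewrite x0 y0.
clearbody T.
have [S SP] := exists_wigner_S T_abs ee.
have S_orth z (ze : ip z e = 0) := (SP z ze).1.
have S_def z (ze : ip z e = 0) := (SP z ze).2.
have [s sP Ss] := wigner_S_semilinear T_abs ee S_orth S_def.
pose res x := x - ip x e *: e.
have rese x : ip (res x) e = 0 by rewrite ipBl ipZl ee mulr1 subrr.
exists (fun x => s (ip x e) *: T e + S (res x)), s; split=> //.
- move=> x; rewrite !(ipDl, ipDr, ipZl, ipZr) (S_orth _ (rese x)) (ip_sym0 (S_orth _ (rese x))).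
  rewrite (wigner_norm T_abs) ee (wigner_S_norm T_abs ee S_orth S_def (rese x)) ip_resid //.
  rewrite mulr1 mulr0 mulr0 addr0 add0r (mul_conj cK) (norm_field_aut _ sP); ring.
- move=> a x y; rewrite ipDl ipZl (field_autD sP) (field_autM sP).
  have -> : res (a *: x + y) = a *: res x + res y.
    rewrite /res ipDl ipZl scalerBr scalerDl scalerA opprD addrACA //.
  rewrite (wigner_S_add T_abs ee S_orth S_def) ?ipZl ?rese ?mulr0 // Ss //.
  by rewrite scalerDl scalerDr -scalerA addrACA.
move=> x xx; rewrite -(Tunit x xx); have [x0|x0] := eqVneq (ip x e) 0.
  have -> : res x = x by rewrite /res x0 scale0r subr0.
  have [c _ ->] := wigner_S_ray T_abs ee S_orth S_def x0.
  exists c; rewrite x0; have -> : s 0 = 0 by apply/eqP;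
    rewrite -normr_eq0 (norm_field_aut _ sP) normr0.
  by rewrite scale0r add0r.
have re : ip ((ip x e)^-1 *: res x) e = 0 by rewrite ipZl rese mulr0.
(* Scaling [x] to have component [e] along [e] brings it to the form [e + z] for which [S] was
   defined. *)
have -> : s (ip x e) *: T e + S (res x) = s (ip x e) *: (T e + S ((ip x e)^-1 *: res x)).
  rewrite scalerDr Ss // scalerA -(field_autM sP) divff //.
  have -> : s 1 = 1 by case: sP => ->; rewrite ?conj1.
  by rewrite scale1r.
have [c _ ->] := S_def _ re.
have [d dE] : exists d, T ((ip x e)^-1 *: x) = d *: T x.
  by apply: (wigner_scale T_abs); rewrite invr_eq0.
have -> : e + (ip x e)^-1 *: res x = (ip x e)^-1 *: x.
  by rewrite /res scalerBr scalerA mulVf // scale1r addrC subrK.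
by exists (s (ip x e) * c * d); rewrite dE !scalerA.
Qed.

(** * Orthogonal projection onto complete subspaces *)

Lemma squeeze0 (t : K) : 0 <= t -> (forall d, 0 < d -> t < d) -> t = 0.
Proof.
move=> t0 lt; apply/eqP/negPn/negP => tn.
by have := lt t; rewrite lt_def t0 tn ltxx => /(_ isT).
Qed.

Lemma norm_add_sqr (a c : K) : `|a + c| ^+ 2 <= 2 * `|a| ^+ 2 + 2 * `|c| ^+ 2.
Proof.
rewrite -(lerD2r (`|a - c| ^+ 2)) -!(mul_conj cK) !(conjD cK) conjN.
rewrite [X in X <= _](_ : _ = 2 * (a * conj a) + 2 * (c * conj c)); last by ring.
by rewrite lerDl -conjN -(conjD cK) (mul_conj cK) exprn_ge0.
Qed.

Lemma parallelogram x y z : ip (x - y) (x - y) =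
  2 * ip (z - x) (z - x) + 2 * ip (z - y) (z - y) -
  4 * ip (z - 2^-1 *: (x + y)) (z - 2^-1 *: (x + y)).
Proof.
have h : conj 2^-1 = 2^-1 by rewrite (conj_nneg cK) // invr_ge0.
by rewrite !(ipBl, ipBr, ipZl, ipZr, ipDl, ipDr) h; field.
Qed.

Definition subspace (S : H -> Prop) :=
  S 0 /\ forall (a : K) x y, S x -> S y -> S (a *: x + y).

Definition complete_subspace (S : H -> Prop) := subspace S /\
  forall u, (forall m, S (u m)) -> cauchy_seq ip u -> exists2 l, S l & converges_to ip u l.

Lemma orth_projection S : complete_subspace S ->
  forall y, exists2 t, S t & forall z, S z -> ip (y - t) z = 0.
Proof.
move=> [[S0 Slin] Scomp] y.
have [||d [d0 dlb dadh]] := exists_inf cK (A := fun a => exists2 t, S t & a = ip (y - t) (y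
  - t)).
- by exists (ip (y - 0) (y - 0)), 0.
- by move=> a [t _ ->]; exact: ip_ge0.
have pos k : 0 < k.+1%:R^-1 :> K by rewrite invr_gt0 ltr0Sn.
have /choice[u uP] k : exists t, S t /\ ip (y - t) (y - t) < d + k.+1%:R^-1.
  by have [_ [t St ->] lt] := dadh _ (pos k); exists t.
have le2 k N : (N <= k)%N -> k.+1%:R^-1 <= N.+1%:R^-1 :> K.
  by move=> Nk; rewrite lef_pV2 ?posrE ?ltr0Sn // ler_nat ltnS.
have [l Sl ul] : exists2 l, S l & converges_to ip u l.
  apply: Scomp => [m|eps eps0]; first by case: (uP m).
  (* The parallelogram law gives [2(d + i) + 2(d + i) - 4d = 4i], hence the factor 4. *)
  have e4 : 0 < eps / 4 by rewrite divr_gt0 ?ltr0n.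
  have [N ltN] := inv_nat_lt cK e4; exists N => m k Nm Nk.
  have [Sm ltm] := uP m; have [Sk ltk] := uP k.
  have : d <= ip (y - 2^-1 *: (u m + u k)) (y - 2^-1 *: (u m + u k)).
    apply: dlb; exists (2^-1 *: (u m + u k)) => //.
    rewrite -[_ *: _]addr0; apply: (Slin) => //.
    by rewrite -[u m]scale1r; apply: Slin.
  rewrite (parallelogram (u m) (u k) y); move: (ip (y - 2^-1 *: _) _) => q dq.
  have ltm' := lt_le_trans ltm (lerD (lexx d) (le2 _ _ Nm)).
  have ltk' := lt_le_trans ltk (lerD (lexx d) (le2 _ _ Nk)).
  move: (ip (y - u m) _) (ip (y - u k) _) ltm' ltk' ltN dq => p r.
  move: (N.+1%:R^-1) => i ltm' ltk' lti dq.
  apply: (@lt_trans _ _ (4 * i)); last by rewrite mulrC -ltr_pdivlMr ?ltr0n.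
  have h1 : 2 * p < 2 * (d + i) by rewrite ltr_pM2l ?ltr0n.
  have h2 : 2 * r < 2 * (d + i) by rewrite ltr_pM2l ?ltr0n.
  have h3 : 4 * d <= 4 * q by rewrite ler_pM2l ?ltr0n.
  have := ltr_leD (ltrD h1 h2) (_ : - (4 * q) <= - (4 * d)); rewrite lerN2 => /(_ h3).
  by rewrite [X in _ < X](_ : _ = 4 * i) //; ring.
exists l => // z Sz; have [->|z0] := eqVneq z 0; first by rewrite ip0r.
have [a a0 uz] := exists_unit z0.
suff : ip (y - l) (a *: z) = 0.
  rewrite ipZr => /eqP; rewrite mulf_eq0 (conj_nneg cK (ltW a0)) gt_eqF //= => /eqP //.
have Sw : S (a *: z) by rewrite -[_ *: _]addr0; apply: Slin.
move: (a *: z) uz Sw => w ww Sw.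
apply/eqP; rewrite -normr_eq0 -sqrf_eq0; apply/eqP.
apply: squeeze0 => [|eps eps0]; first by rewrite exprn_ge0.
have e4 : 0 < eps / 4 by rewrite divr_gt0 ?ltr0n.
have [N ltN] := inv_nat_lt cK e4; have [M ltM] := ul _ e4.
pose m := maxn N M; have [Sm ltm] := uP m.
(* Moving [u m] along [w] lowers the squared distance by exactly this quantity, and there is less
   than [1 / (m + 1)] left above the infimum. *)
have h1 : `|ip (y - u m) w| ^+ 2 < eps / 4.
  have : d <= ip (y - u m - ip (y - u m) w *: w) (y - u m - ip (y - u m) w *: w).
    apply: dlb; exists (ip (y - u m) w *: w + u m); first exact: Slin.
    by rewrite opprD addrA addrAC.
  rewrite ip_resid // lerBrDl => le1; have := le_lt_trans le1 ltm.
  rewrite addrC ltrD2l => lt1; apply: lt_trans (lt_le_trans lt1 _) ltN.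
  by apply: le2; exact: leq_maxl.
have h2 : `|ip (u m - l) w| ^+ 2 < eps / 4.
  apply: le_lt_trans (norm_ip_le _ ww) (ltM _ _); exact: leq_maxr.
have -> : ip (y - l) w = ip (y - u m) w + ip (u m - l) w by rewrite -ipDl addrA subrK.
apply: le_lt_trans (norm_add_sqr _ _) _.
have -> : eps = 2 * (eps / 4) + 2 * (eps / 4) by field.
by apply: ltrD; rewrite ltr_pM2l ?ltr0n.
Qed.

(** * Semilinear isometries and the theorem for finite rank *)

Hypothesis ip_complete : is_complete ip.

Section Semilinear.
Variables (V : H -> H) (s : K -> K).
Hypothesis s_aut : field_aut s.
Hypothesis V_semilin : forall a x y, V (a *: x + y) = s a *: V x + V y.

Lemma semilin_add x y : V (x + y) = V x + V y.
Proof. by have := V_semilin 1 x y; rewrite (field_aut1 s_aut) !scale1r. Qed.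

Lemma semilin0 : V 0 = 0.
Proof. by apply: (addrI (V 0)); rewrite -semilin_add !addr0. Qed.

Lemma semilin_scale a x : V (a *: x) = s a *: V x.
Proof. by have := V_semilin a x 0; rewrite semilin0 !addr0. Qed.

Lemma semilin_sub x y : V (x - y) = V x - V y.
Proof.
by apply: (addIr (V y)); rewrite -semilin_add !subrK.
Qed.

Lemma semilin_sum (I : finType) (A : {pred I}) (F : I -> H) :
  V (\sum_(i in A) F i) = \sum_(i in A) V (F i).
Proof. by rewrite (big_morph V semilin_add semilin0). Qed.

Hypothesis V_isom : is_isometry ip V.

Lemma semilin_ip x y : ip (V x) (V y) = s (ip x y).
Proof.
set d := ip (V x) (V y) - s (ip x y).
have key a : conj a * d + a * conj d = 0.
  have := V_isom (x + s a *: y); rewrite semilin_add semilin_scale (field_autK s_aut).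
  rewrite !(ipDl, ipDr, ipZl, ipZr) !V_isom => E.
  have Er : conj (s a) * ip x y + s a * ip y x = conj a * s (ip x y) + a * conj (s (ip x y)).
    rewrite -[LHS](field_aut_real s_aut); last first.
      by rewrite (conjD cK) !(conjM cK) (conjK cK) -!ipC addrC.
    rewrite (field_autD s_aut) !(field_autM s_aut) -(field_aut_conj _ s_aut) !(field_autK
      s_aut).
    by rewrite -(field_aut_conj _ s_aut) -ipC.
  move/eqP: E; rewrite -subr_eq0 => /eqP E;
    rewrite -[RHS]E /d (conjD cK) conjN -[conj (ip _ _)]ipC.
  have sa : s a * conj (s a) = a * conj a.
    by rewrite !(mul_conj cK) (norm_field_aut _ s_aut).
  transitivity (conj a * ip (V x) (V y) + a * ip (V y) (V x) -
    (conj (s a) * ip x y + s a * ip y x)); first by rewrite Er; ring.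
  rewrite (mulrA (s a)) sa; ring.
have := key d; rewrite mulrC -mulr2n => /eqP; rewrite mulrn_eq0 /= (mul_conj cK).
by rewrite sqrf_eq0 normr_eq0 subr_eq0 => /eqP.
Qed.

(** The range of an isometry on a complete space is complete; [Vs y] is the preimage of the
    orthogonal projection of [y] onto it. *)
Lemma semilin_adjoint : exists Vs, forall x y, ip (V x) y = s (ip x (Vs y)).
Proof.
have comp : complete_subspace (range V).
  split; first split.
  - by exists 0; rewrite semilin0.
  - by move=> a _ _ [x ->] [y ->]; exists (s a *: x + y); rewrite V_semilin (field_autK s_aut).
  move=> u /choice[x ux] cu.
  have [|l xl] := ip_complete (u := x).
    move=> d /cu[N lt]; exists N => m k Nm Nk; have := lt m k Nm Nk.
    by rewrite !ux -semilin_sub V_isom.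
  exists (V l); first by exists l.
  move=> d /xl[N lt]; exists N => m Nm; rewrite ux -semilin_sub V_isom; exact: lt.
have /choice[Vs VsP] y : exists t, forall x, ip (V x) y = s (ip x t).
  have [_ [t ->] orth_t] := orth_projection comp y; exists t => x.
  rewrite -semilin_ip; have := ip_sym0 (orth_t (V x) (ex_intro _ x erefl)).
  by rewrite ipBr => /eqP; rewrite subr_eq0 => /eqP.
by exists Vs.
Qed.

End Semilinear.

Lemma semilinear_cases V Vs s : field_aut s ->
  (forall a x y, V (a *: x + y) = s a *: V x + V y) ->
  (forall x y, ip (V x) y = s (ip x (Vs y))) ->
  (is_linear V /\ is_adjoint ip V Vs) \/
  (is_conj_linear conj V /\ is_conj_adjoint conj ip V Vs).
Proof. by case=> -> ? ?; [left | right]. Qed.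

Lemma rank_full_id n P : proj_rank ip n P -> ~ dim_ge H n.+1 -> forall x, P x = x.
Proof.
move=> rP ndim x; have [f of_ ->] := proj_rank_basis rP.
apply/esym/eqP; rewrite -subr_eq0; apply/negPn/negP => z0; apply: ndim.
have [a a0 uu] := exists_unit z0.
apply: (@on_dim_ge _ _ (ocons (a *: (x - pj setT f x)) f)) => //.
apply: on_ocons => // i; by rewrite ipZl ipBl ip_pj_on // inE subrr mulr0.
Qed.

Lemma has_dim_of_ge m : dim_ge H m -> ~ dim_ge H m.+1 -> has_dim H m.
Proof.
move=> dimm ndim.
have [||f [of_ _ _]] := @exists_on (fun _ => True) m _ m [::] => //.
  by move=> l; apply: dim_ge_orth_unit.
exists f; split=> //; split; first exact: on_lin_indep.
move=> y _; exists (fun i => ip y (f i)).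
have rf : proj_rank ip m (pj setT f).
  by rewrite -{1}(card_ord m) -cardsT; exact: proj_rank_pj.
by rewrite -[LHS](rank_full_id rf ndim); apply: eq_bigl => i; rewrite inE.
Qed.

Lemma finite_case n (phi : (H -> H) -> (H -> H)) :
  (forall P, proj_rank ip n P -> proj_rank ip n (phi P)) ->
  (forall P Q, proj_rank ip n P -> proj_rank ip n Q -> angle_eq ip (phi P) (phi Q) P Q) ->
  n = 1%N \/ ~ has_dim H (n + n) ->
  exists V Vs : H -> H, is_isometry ip V /\
    ((is_linear V /\ is_adjoint ip V Vs) \/
     (is_conj_linear conj V /\ is_conj_adjoint conj ip V Vs)) /\
    (forall P, proj_rank ip n P -> phi P = V \o P \o Vs).
Proof.
move=> phi_rank phi_angle dimH.
(* Covers [n = 0] and [dim H = n], where there is only one projection of rank [n] and no system of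
   [n + 1] vectors need exist. *)
have trivial : (forall P Q, proj_rank ip n P -> proj_rank ip n Q -> P = Q) ->
    exists V Vs : H -> H, is_isometry ip V /\
    ((is_linear V /\ is_adjoint ip V Vs) \/
     (is_conj_linear conj V /\ is_conj_adjoint conj ip V Vs)) /\
    (forall P, proj_rank ip n P -> phi P = V \o P \o Vs).
  move=> uniq; exists id, id; split=> //; split; first by left.
  by move=> P rP; exact: uniq (phi_rank _ rP) rP.
have [n0|n0] := posnP n.
  apply: trivial => P Q rP rQ; subst n.
  have [f _ ->] := proj_rank_basis rP; have [g _ ->] := proj_rank_basis rQ.
  by apply/funext => x; rewrite /pj !big1 // => -[].
have [dimS|ndimS] := pselect (dim_ge H n.+1); last first.
  by apply: trivial => P Q rP rQ; apply/funext => x; rewrite !(rank_full_id _ ndimS).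
have dim' : n = 1%N \/ (dim_ge H (n + n).+1 \/ ~ dim_ge H (n + n)).
  case: dimH => [->|ndim]; first by left.
  right; have [|nd] := pselect (dim_ge H (n + n).+1); first by left.
  by right=> d; apply: ndim; apply: has_dim_of_ge.
have [chi [chi_abs chi_proj]] := finite_lines phi_rank phi_angle n0 dimS dim'.
have [V [s [V_isom s_aut V_semi V_chi]]] := wigner chi_abs.
have [Vs VsP] := semilin_adjoint s_aut V_semi V_isom.
exists V, Vs; split=> //; split; first exact: semilinear_cases s_aut V_semi VsP.
move=> P rP; have [f of_ eP] := proj_rank_basis rP.
have oVf : orthonormal (V \o f).
  move=> i j; rewrite /= (semilin_ip s_aut V_semi V_isom) of_.
  by case: (i == j); rewrite ?mulr1n ?mulr0n ?(field_aut1 s_aut) ?(field_aut0 s_aut).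
(* [V (f i)] is a multiple of [chi (f i)], on which the quadratic form of [phi P] takes the same
   value 1 as that of [P] on [f i]. *)
rewrite (proj_rank_on (phi_rank P rP) oVf); last first.
  move=> i; have [c /= ->] := V_chi _ (on_unit i of_).
  have [pP' _] := phi_rank P rP; rewrite (linear_scale (proj_lin pP')); congr (_ *: _).
  have [chi1 chiP] := chi_proj P _ rP (on_unit i of_).
  by apply: proj_fixed => //; rewrite chiP chi1 eP pj_on // inE (on_unit i of_).
apply/funext => x; rewrite /= eP /pj (semilin_sum s_aut V_semi).
apply: eq_bigr => i _; rewrite (semilin_scale s_aut V_semi) /=.
by rewrite ipC VsP -(field_aut_conj _ s_aut) -ipC.
Qed.

(** * Projections of infinite rank *)

Definition infinite_proj (P : H -> H) := is_projection ip P /\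
  forall l : seq H, exists u, [/\ P u = u, ip u u = 1 & forall y, y \in l -> ip u y = 0].

Lemma infinite_is_proj P : infinite_proj P -> is_projection ip P.
Proof. by case. Qed.

Lemma infinite_projP P : proj_inf_rank ip P <-> infinite_proj P.
Proof.
split=> -[pP inf]; split=> //.
  move=> l; have [v [rv iv]] := inf (size l).+1.
  have [u [c [uc uu ul]]] := exists_orth_unit iv (ltnSn _).
  by exists u; split=> //; apply/(range_fix _ pP); rewrite uc; exact: range_sum.
move=> m; have [f [of_ Pf _]] := exists_on (fun l _ => inf l) (leqnn (size [::] + m)).
exists f; split; last exact: on_lin_indep.
by move=> i; apply/(range_fix _ pP).
Qed.

Definition le_proj (M P : H -> H) := forall x, P (M x) = M x.

Definition compl_proj (P : H -> H) x := x - P x.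

Lemma le_proj_comp M P : is_projection ip M -> is_projection ip P -> le_proj M P ->
  forall x, M (P x) = M x.
Proof.
move=> pM pP MP x; apply: ip_injl => z.
by rewrite (proj_adj pM) (proj_adj pP) MP (proj_adj pM).
Qed.

Lemma le_proj_trans P M Q : le_proj M P -> le_proj P Q -> le_proj M Q.
Proof. by move=> MP PQ x; rewrite -MP PQ. Qed.

Lemma le_proj_anti P Q : is_projection ip P -> is_projection ip Q ->
  le_proj P Q -> le_proj Q P -> P = Q.
Proof. by move=> pP pQ PQ QP; apply: proj_ext. Qed.

Lemma infinite_le P Q : is_projection ip Q -> infinite_proj P -> le_proj P Q ->
  infinite_proj Q.
Proof.
move=> pQ [_ inf] PQ; split=> // l; have [u [Pu uu ul]] := inf l.
by exists u; split=> //; rewrite -Pu PQ.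
Qed.

Lemma proj_compl P : is_projection ip P -> is_projection ip (compl_proj P).
Proof.
move=> pP; apply: projI.
- move=> a x y; rewrite /compl_proj (proj_lin pP) scalerBr opprD addrACA //.
- by move=> x; rewrite /compl_proj (linear_sub (proj_lin pP)) (proj_idem pP) subrr subr0.
- by move=> x y; rewrite ipBl ipBr (proj_adj pP).
Qed.

Lemma compl_projK P : compl_proj (compl_proj P) = P.
Proof. by apply/funext => x; rewrite /compl_proj opprB addrC subrK. Qed.

Lemma orth_sym P Q : is_projection ip P -> is_projection ip Q -> orth P Q -> orth Q P.
Proof.
move=> pP pQ PQ x; apply: ip_injl => z.
by rewrite (proj_adj pQ) (proj_adj pP) PQ ip0l ip0r.
Qed.

Lemma orth_compl P : is_projection ip P -> orth (compl_proj P) P.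
Proof. by move=> pP x; rewrite /compl_proj (proj_idem pP) subrr. Qed.

Lemma orth_compl_le M P : orth (compl_proj P) M <-> le_proj M P.
Proof.
split=> MP x; last by rewrite /compl_proj MP subrr.
by have /eqP := MP x; rewrite subr_eq0 => /eqP.
Qed.

Lemma orth_le_compl P R : is_projection ip P -> is_projection ip R -> orth R P ->
  le_proj R (compl_proj P).
Proof.
by move=> pP pR RP x; rewrite /compl_proj (orth_sym pR pP RP) subr0.
Qed.

Lemma exists_between M P : is_projection ip M -> is_projection ip P -> le_proj M P ->
  ~ le_proj P M -> exists x, [/\ ip x x = 1, P x = x & M x = 0].
Proof.
move=> pM pP MP /existsNP[y /eqP]; rewrite eq_sym -subr_eq0 => z0.
have [a a0 uu] := exists_unit z0; exists (a *: (P y - M (P y))); split=> //.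
  by rewrite (linear_scale (proj_lin pP)) (linear_sub (proj_lin pP)) (proj_idem pP) MP.
by rewrite (linear_scale (proj_lin pM)) (linear_sub (proj_lin pM)) (proj_idem pM) subrr scaler0.
Qed.

(** For a unit vector [u] with [M u = 0], the projection onto the range of [M] plus the line of
    [u]. *)
Definition add_line (M : H -> H) (u x : H) := M x + ip x u *: u.

Definition sub_line (M : H -> H) (u x : H) := M x - ip x u *: u.

Lemma add_line_self M u : ip u u = 1 -> M u = 0 -> add_line M u u = u.
Proof. by move=> uu Mu; rewrite /add_line Mu uu scale1r add0r. Qed.

Lemma proj_add_line M u : is_projection ip M -> ip u u = 1 -> M u = 0 ->
  is_projection ip (add_line M u).
Proof.
move=> pM uu Mu; apply: projI.
- move=> a x y; rewrite /add_line (proj_lin pM) ipDl ipZl scalerDl scalerDr scalerA.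
  by rewrite addrACA.
- move=> x; rewrite /add_line (linear_add (proj_lin pM)) (linear_scale (proj_lin pM)).
  rewrite (proj_idem pM) Mu scaler0 addr0; congr (_ + _ *: _).
  by rewrite ipDl ipZl uu mulr1 (proj_adj pM) Mu ip0r add0r.
- move=> x y; rewrite !(ipDl, ipDr, ipZl, ipZr) (proj_adj pM); congr (_ + _).
  by rewrite -ipC mulrC.
Qed.

Lemma proj_sub_line P u : is_projection ip P -> ip u u = 1 -> P u = u ->
  is_projection ip (sub_line P u).
Proof.
move=> pP uu Pu; apply: projI.
- move=> a x y; rewrite /sub_line (proj_lin pP) ipDl ipZl scalerDl scalerBr scalerA.
  by rewrite opprD addrACA.
- move=> x; rewrite /sub_line (linear_sub (proj_lin pP)) (linear_scale (proj_lin pP)).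
  rewrite (proj_idem pP) Pu ipBl ipZl uu mulr1 (proj_adj pP) Pu subrr scale0r subr0 //.
- move=> x y; rewrite !(ipBl, ipBr, ipZl, ipZr) (proj_adj pP); congr (_ - _).
  by rewrite -ipC mulrC.
Qed.

Lemma sub_lineK P u : add_line (sub_line P u) u = P.
Proof. by apply/funext => x; rewrite /add_line /sub_line subrK. Qed.

Lemma sub_line_self P u : ip u u = 1 -> P u = u -> sub_line P u u = 0.
Proof. by move=> uu Pu; rewrite /sub_line Pu uu scale1r subrr. Qed.

Lemma le_add_line M u : is_projection ip M -> M u = 0 -> le_proj M (add_line M u).
Proof.
by move=> pM Mu x; rewrite /add_line (proj_idem pM) (proj_adj pM) Mu ip0r scale0r addr0.
Qed.

Lemma add_line_le M u P : is_linear P -> le_proj M P -> P u = u -> le_proj (add_line M u) P.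
Proof.
move=> lP MP Pu x; rewrite /add_line (linear_add lP) (linear_scale lP).
by rewrite MP Pu.
Qed.

Lemma add_line_eq M x y : ip x x = 1 -> ip y y = 1 -> M x = 0 -> M y = 0 ->
  add_line M x = add_line M y <-> `|ip x y| ^+ 2 = 1.
Proof.
move=> xx yy Mx My; split=> [E|c1].
  have := add_line_self xx Mx; rewrite E /add_line Mx add0r => {E} E.
  by have := xx; rewrite -{1}E ipZl -sqr_norm_ip.
apply/funext => z; rewrite /add_line; congr (_ + _).
have xE : x = ip x y *: y by apply: norm_ip_eq; rewrite ?c1.
rewrite xE ipZr scalerA mulrAC [conj _ * _]mulrC (mul_conj cK) c1 mul1r //.
Qed.

(** [A x] is a multiple of [x], and idempotency leaves only the factors 0 and 1. *)
Lemma add_line_between M x A : is_projection ip M -> is_projection ip A ->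
  ip x x = 1 -> M x = 0 -> le_proj M A -> le_proj A (add_line M x) ->
  A = M \/ A = add_line M x.
Proof.
move=> pM pA xx Mx MA AP.
have MA' := le_proj_comp pM pA MA.
have Ax : A x = ip (A x) x *: x.
  by rewrite -{1}(AP x) /add_line MA' Mx add0r.
have AE y : A y = M y + ip y x *: A x.
  have pP := proj_add_line pM xx Mx.
  rewrite -(le_proj_comp pA pP AP) /add_line (linear_add (proj_lin pA)) MA.
  by rewrite (linear_scale (proj_lin pA)).
have := proj_idem pA x; rewrite {1}Ax (linear_scale (proj_lin pA)).
have [c0|c0] := eqVneq (A x) 0 => E.
  by left; apply/funext => y; rewrite AE c0 scaler0 addr0.
right; apply/funext => y; rewrite AE /add_line; suff -> : A x = x by [].
have /eqP := E; rewrite -subr_eq0 -[X in _ - X]scale1r -scalerBl scaler_eq0 (negPf c0) orbF.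
by rewrite subr_eq0 => /eqP c1; rewrite Ax c1 scale1r.
Qed.

Definition biinfinite (P : H -> H) := infinite_proj P /\ infinite_proj (compl_proj P).

Lemma biinfinite_compl P : biinfinite P -> biinfinite (compl_proj P).
Proof. by case=> bP bC; split; rewrite ?compl_projK. Qed.

Lemma biinfinite_proj P : biinfinite P -> is_projection ip P.
Proof. by case=> -[]. Qed.

Lemma biinfinite_le M P : infinite_proj M -> biinfinite P -> le_proj M P -> biinfinite M.
Proof.
move=> bM [[pP _] bC] MP; split=> //; have [pM _] := bM.
apply: infinite_le bC _; first exact: proj_compl.
move=> x; rewrite /compl_proj (linear_sub (proj_lin pM)) (le_proj_comp pM pP MP).
by rewrite subrr subr0.
Qed.

Lemma biinfinite_add_line M u : biinfinite M -> ip u u = 1 -> M u = 0 ->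
  biinfinite (add_line M u).
Proof.
move=> [bM [pC infC]] uu Mu; have [pM _] := bM.
have pP := proj_add_line pM uu Mu; split.
  exact: infinite_le pP bM (le_add_line pM Mu).
split; first exact: proj_compl.
move=> l; have [v [Cv vv vl]] := infC (u :: l); exists v; split=> //.
  rewrite /compl_proj /add_line (vl u) ?mem_head // scale0r addr0; exact: Cv.
by move=> y yl; apply: vl; rewrite inE yl orbT.
Qed.

Lemma biinfinite_sub_line P u : biinfinite P -> ip u u = 1 -> P u = u ->
  biinfinite (sub_line P u).
Proof.
move=> bP uu Pu; have [[pP inf] _] := bP.
have pM := proj_sub_line pP uu Pu.
apply: (biinfinite_le _ bP); last first.
  by move=> x; rewrite /sub_line (linear_sub (proj_lin pP)) (proj_idem pP) (linear_scale
    (proj_lin pP)) Pu.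
split=> // l; have [v [Pv vv vl]] := inf (u :: l); exists v; split=> //.
  by rewrite /sub_line Pv (vl u) ?mem_head // scale0r subr0.
by move=> y yl; apply: vl; rewrite inE yl orbT.
Qed.

(** The closed span of [A] is encoded as its double orthogonal complement, which is closed because
    the inner product is continuous. *)
Lemma span_projection (A : H -> Prop) : exists T, [/\ is_projection ip T,
  forall a, A a -> T a = a & forall y, (forall a, A a -> ip y a = 0) -> T y = 0].
Proof.
pose S x := forall y, (forall a, A a -> ip y a = 0) -> ip x y = 0.
have comp : complete_subspace S.
  split; first split.
  - by move=> y _; rewrite ip0l.
  - by move=> a x y Sx Sy z Az; rewrite ipDl ipZl Sx // Sy // mulr0 addr0.
  move=> u Su /ip_complete[l ul]; exists l => // y Ay.
  apply/eqP; rewrite -normr_eq0 -sqrf_eq0; apply/eqP.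
  have [->|y0] := eqVneq y 0; first by rewrite ip0r normr0 expr0n.
  have yy : 0 < ip y y by rewrite lt_def ip_ge0 ip_eq0 y0.
  apply: squeeze0 => [|d d0]; first by rewrite exprn_ge0.
  have [N /(_ N (leqnn N)) lt] := ul _ (divr_gt0 d0 yy).
  have -> : `|ip l y| ^+ 2 = `|ip (u N - l) y| ^+ 2 by rewrite ipBl (Su N y Ay) sub0r normrN.
  by apply: le_lt_trans (cauchy_schwarz _ _) _; rewrite -ltr_pdivlMr.
have [[S0 Slin] _] := comp.
have /choice[T TP] y : exists t, S t /\ forall z, S z -> ip (y - t) z = 0.
  by have [t St tz] := orth_projection comp y; exists t.
have ST x : S (T x) := (TP x).1.
have T_ip x y : ip (T x) y = ip (T x) (T y).
  by apply/eqP; rewrite -subr_eq0 -ipBr; apply/eqP/ip_sym0; exact: (TP y).2.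
have T_fix x : S x -> T x = x.
  move=> Sx; apply/esym/eqP; rewrite -subr_eq0 -ip_eq0; apply/eqP; apply: (TP x).2.
  by rewrite addrC -scaleN1r; exact: Slin (ST x) Sx.
have aT : is_adjoint ip T T.
  by move=> x y; rewrite T_ip (ipC (T y) x) (T_ip y x) -ipC.
exists T; split.
- apply: projI => // [a x y|x]; last exact: T_fix.
  apply: ip_injl => z; by rewrite aT !(ipDl, ipZl) !aT.
- by move=> a Aa; apply: T_fix => y Ay; apply: ip_sym0; apply: Ay.
- by move=> y Ay; apply/eqP; rewrite -ip_eq0 -T_ip (ST y).
Qed.

Lemma exists_on_seq (Q : nat -> H -> Prop) :
  (forall k (l : seq H), exists u, [/\ Q k u, ip u u = 1 & forall y, y \in l -> ip u y = 0]) ->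
  exists m : nat -> H, (forall k, Q k (m k)) /\ forall i j, ip (m i) (m j) = (i == j)%:R.
Proof.
move=> ex; have /choice[g gP] (p : nat * seq H) : exists u,
    [/\ Q p.1 u, ip u u = 1 & forall y, y \in p.2 -> ip u y = 0] by apply: ex.
pose fix L k := if k is k'.+1 then g (k', L k') :: L k' else [::].
have memL i j : (i < j)%N -> g (i, L i) \in L j.
  elim: j => // j IH; rewrite ltnS leq_eqVlt => /orP[/eqP->|/IH ij] /=; first exact: mem_head.
  by rewrite inE ij orbT.
have lt0 i j : (i < j)%N -> ip (g (j, L j)) (g (i, L i)) = 0.
  by move=> ij; have [_ _] := gP (j, L j); apply; apply: memL.
exists (fun k => g (k, L k)); split=> [k|i j]; first by have [] := gP (k, L k).
case: (ltngtP i j) => [ij|ji|->]; [exact/ip_sym0/lt0 | exact: lt0 |].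
by have [_ ->] := gP (j, L j).
Qed.

Lemma infinite_of_seq P (m : nat -> H) : is_projection ip P ->
  (forall i j, ip (m i) (m j) = (i == j)%:R) -> (forall k, P (m k) = m k) -> infinite_proj P.
Proof.
move=> pP om Pm; split=> // l.
have of_ : orthonormal (fun i : 'I_(size l).+1 => m i) by move=> i j; rewrite om.
have [u [c [uc uu ul]]] := exists_orth_unit (on_lin_indep of_) (ltnSn _).
exists u; split=> //; apply/(range_fix _ pP); rewrite uc; apply: range_sum => // i.
exact/range_fix.
Qed.

Lemma span_le (A : H -> Prop) T P : is_projection ip T -> is_projection ip P ->
  (forall y, (forall a, A a -> ip y a = 0) -> T y = 0) -> (forall a, A a -> P a = a) ->
  le_proj T P.
Proof.
move=> pT pP T0 PA.
have TP x : T (P x) = T x.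
  apply/esym/eqP; rewrite -subr_eq0 -(linear_sub (proj_lin pT)); apply/eqP/T0 => a /PA <-.
  by rewrite -(proj_adj pP) (linear_sub (proj_lin pP)) (proj_idem pP) subrr ip0l.
by move=> x; apply: ip_injl => z; rewrite (proj_adj pP) (proj_adj pT) TP (proj_adj pT).
Qed.

(** Take an orthonormal sequence in the range of [P] orthogonal to [l] and span its even terms; the
    odd terms keep the complement infinite. *)
Lemma exists_biinfinite P (l : seq H) : infinite_proj P ->
  exists T, [/\ biinfinite T, le_proj T P & forall y, y \in l -> T y = 0].
Proof.
move=> [pP inf].
have [|m [mP om]] := @exists_on_seq (fun _ u => P u = u /\ forall y, y \in l -> ip u y = 0).
  move=> _ l'; have [u [Pu uu ul]] := inf (l ++ l'); exists u; split=> //.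
    by split=> // y yl; apply: ul; rewrite mem_cat yl.
  by move=> y yl; apply: ul; rewrite mem_cat yl orbT.
have [T [pT TA T0]] := span_projection (fun a => exists k, a = m k.*2).
exists T; split.
- split.
    apply: (infinite_of_seq (m := fun k => m k.*2)) => // [i j|k]; last by apply: TA; exists k.
    by rewrite om; congr (_%:R); rewrite -!muln2 eqn_pmul2r.
  apply: (infinite_of_seq (m := fun k => m k.*2.+1)); first exact: proj_compl.
    by move=> i j; rewrite om eqSS -!muln2 eqn_pmul2r.
  move=> k; rewrite /compl_proj T0 ?subr0 // => _ [j ->]; rewrite om.
  by case: eqP => // E; have := congr1 odd E; rewrite /= !odd_double.
- by apply: span_le pT pP T0 _ => _ [k ->]; have [] := mP k.*2.
- move=> y yl; apply: T0 => _ [k ->]; apply: ip_sym0; exact: (mP k.*2).2.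
Qed.

(** * Maps on projections of infinite rank *)

Section InfiniteRank.
Variable phi : (H -> H) -> (H -> H).
Hypothesis phi_inf : forall P, infinite_proj P -> infinite_proj (phi P).
Hypothesis phi_surj : forall Q, infinite_proj Q -> exists2 P, infinite_proj P & phi P = Q.
Hypothesis phi_angle : forall P Q, infinite_proj P -> infinite_proj Q ->
  angle_eq ip (phi P) (phi Q) P Q.
Hypothesis H_inf : infinite_proj id.

Lemma phi_proj P : infinite_proj P -> is_projection ip (phi P).
Proof. by move=> /phi_inf[]. Qed.

Lemma phi_orth P Q : infinite_proj P -> infinite_proj Q -> orth P Q <-> orth (phi P) (phi Q).
Proof.
move=> iP iQ; split; last first.
  apply: angle_orth (angle_sym (phi_angle iP iQ)); try exact: phi_proj; exact: infinite_is_proj.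
by apply: angle_orth (phi_angle iP iQ); try exact: phi_proj; exact: infinite_is_proj.
Qed.

Lemma phi_comm P Q : infinite_proj P -> infinite_proj Q ->
  commuting P Q -> commuting (phi P) (phi Q).
Proof.
move=> iP iQ; apply: angle_comm (phi_angle iP iQ); try exact: phi_proj; exact: infinite_is_proj.
Qed.

Lemma phi_biinf P : biinfinite P -> biinfinite (phi P).
Proof.
move=> [iP iC]; split; first exact: phi_inf.
apply: infinite_le (phi_inf iC) _; first exact/proj_compl/phi_proj.
apply: orth_le_compl; [exact: phi_proj | exact: phi_proj|].
by apply/(phi_orth iC iP); apply: orth_compl; exact: infinite_is_proj.
Qed.

Lemma phi_biinf_inv P : infinite_proj P -> biinfinite (phi P) -> biinfinite P.
Proof.
move=> iP [_ iC]; split=> //; have [R iR eR] := phi_surj iC.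
apply: (infinite_le _ iR); first exact/proj_compl/infinite_is_proj.
apply: orth_le_compl; [exact: infinite_is_proj | exact: infinite_is_proj|].
by apply/(phi_orth iR iP); rewrite eR; apply: orth_compl; exact: phi_proj.
Qed.

(** [M] is below [P] exactly when it is orthogonal to the complement of [P]. In the forward
    direction the complement of [phi P] is first written as some [phi R]. *)
Lemma phi_le M P : infinite_proj M -> biinfinite P -> le_proj M P <-> le_proj (phi M) (phi P).
Proof.
move=> iM bP; have [iP iC] := bP; have [_ iC'] := phi_biinf bP.
have orth_mono R A B : is_projection ip R -> le_proj A B -> orth R B -> orth R A.
  by move=> pR AB RB x; rewrite -AB RB.
split=> MP.
  have [R iR eR] := phi_surj iC'; apply/orth_compl_le; rewrite -eR.
  apply/(phi_orth iR iM); apply: orth_mono MP _; first exact: infinite_is_proj.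
  by apply/(phi_orth iR iP); rewrite eR; apply: orth_compl; exact: phi_proj.
apply/orth_compl_le/(phi_orth iC iM); apply: orth_mono MP _; first exact: phi_proj.
by apply/(phi_orth iC iP); apply: orth_compl; exact: infinite_is_proj.
Qed.

Lemma phi_inj P Q : biinfinite P -> biinfinite Q -> phi P = phi Q -> P = Q.
Proof.
move=> bP bQ E; have [iP _] := bP; have [iQ _] := bQ.
apply: le_proj_anti; try exact: infinite_is_proj.
  by apply/(phi_le iP bQ); rewrite E => x; rewrite (proj_idem (phi_proj iQ)).
by apply/(phi_le iQ bP); rewrite E => x; rewrite (proj_idem (phi_proj iQ)).
Qed.

Lemma phi_compl P : biinfinite P -> phi (compl_proj P) = compl_proj (phi P).
Proof.
move=> bP; have [iP iC] := bP; have [_ iC'] := phi_biinf bP.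
apply: le_proj_anti; [exact: phi_proj | by case: iC' | |].
  apply: orth_le_compl; try exact: phi_proj.
  by apply/(phi_orth iC iP); apply: orth_compl; exact: infinite_is_proj.
have [R iR eR] := phi_surj iC'; rewrite -eR; apply/(phi_le iR (biinfinite_compl bP)).
apply: orth_le_compl; try exact: infinite_is_proj.
by apply/(phi_orth iR iP); rewrite eR; apply: orth_compl; exact: phi_proj.
Qed.

Definition line_image M x u :=
  [/\ ip u u = 1, phi M u = 0 & phi (add_line M x) = add_line (phi M) u].

(* [phi] is an order automorphism of the biinfinite projections, hence it
   preserves the covering relation. *)
Lemma exists_line_image M x : biinfinite M -> ip x x = 1 -> M x = 0 ->
  exists u, line_image M x u.
Proof.
move=> bM xx Mx; have [iM _] := bM; have pM := infinite_is_proj iM.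
pose P := add_line M x; have bP : biinfinite P by exact: biinfinite_add_line.
have [iP _] := bP; have MP : le_proj M P by exact: le_add_line.
have nPM : ~ le_proj (phi P) (phi M).
  move/(phi_le iP bM) => /(_ x); rewrite /P add_line_self // Mx => x0.
  by move/eqP: xx; rewrite -x0 ip0l eq_sym oner_eq0.
have [u [uu Pu Mu]] := exists_between (phi_proj iM) (phi_proj iP) ((phi_le iM bP).1 MP) nPM.
exists u; split=> //; pose A' := add_line (phi M) u.
have bA' : biinfinite A' by apply: biinfinite_add_line => //; exact: phi_biinf.
have [iA' _] := bA'; have [A iA eA] := phi_surj iA'.
have bA : biinfinite A by apply: phi_biinf_inv; rewrite // eA.
have AP : le_proj A P.
  apply/(phi_le iA bP); rewrite eA; apply: add_line_le => //; first exact/proj_lin/phi_proj.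
  exact/(phi_le iM bP).
have MA : le_proj M A.
  by apply/(phi_le iM bA); rewrite eA; apply: le_add_line => //; exact: phi_proj.
have [E|<-] := add_line_between pM (infinite_is_proj iA) xx Mx MA AP; last by [].
have := add_line_self uu Mu; rewrite -/A' -eA E Mu => u0.
by move/eqP: uu; rewrite -u0 ip0l eq_sym oner_eq0.
Qed.

Lemma add_line_QPQ M x y : is_projection ip M -> ip x x = 1 -> ip y y = 1 ->
  M x = 0 -> M y = 0 ->
  add_line M y (add_line M x (add_line M y y)) = `|ip x y| ^+ 2 *: y.
Proof.
move=> pM xx yy Mx My; rewrite add_line_self // {2}/add_line My add0r.
rewrite /add_line (linear_scale (proj_lin pM)) Mx scaler0 add0r ipZl.
by rewrite sqr_norm_ip mulrC.
Qed.

(** [QPQ] is the identity on the range of [M], multiplies [y] by the squared modulus of [ip x y],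
    and vanishes on the rest. *)
Lemma add_line_eigenvalue M x y v t : is_projection ip M -> ip x x = 1 -> ip y y = 1 ->
  M x = 0 -> M y = 0 -> v != 0 ->
  add_line M y (add_line M x (add_line M y v)) = t *: v ->
  [\/ t = 0, t = 1 | t = `|ip x y| ^+ 2].
Proof.
move=> pM xx yy Mx My v0 E.
have pQ := proj_add_line pM yy My; have pP := proj_add_line pM xx Mx.
have MQ z : M (add_line M y z) = M z by apply: le_proj_comp => //; exact: le_add_line.
have MP z : M (add_line M x z) = M z by apply: le_proj_comp => //; exact: le_add_line.
have Mv : M v = t *: M v by rewrite -(linear_scale (proj_lin pM)) -E MQ MP MQ.
have yv : `|ip x y| ^+ 2 * ip v y = t * ip v y.
  rewrite -ipZl -E (proj_adj pQ) (proj_adj pP) (proj_adj pQ) add_line_QPQ // ipZr.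
  by rewrite (conj_nneg cK) // exprn_ge0.
have [t1|t1] := eqVneq t 1; first by apply: Or32.
have [tc|tc] := eqVneq t (`|ip x y| ^+ 2); first by apply: Or33.
apply: Or31; have Mv0 : M v = 0.
  apply/eqP; move/eqP: Mv; rewrite -subr_eq0 -{1}[M v]scale1r -scalerBl scaler_eq0.
  by rewrite subr_eq0 eq_sym (negPf t1).
have yv0 : ip v y = 0.
  apply/eqP; move/eqP: yv; rewrite -subr_eq0 -mulrBl mulf_eq0.
  by rewrite subr_eq0 eq_sym (negPf tc).
move: E; rewrite {3}/add_line Mv0 yv0 scale0r addr0 (linear0 (proj_lin pP)) (linear0
  (proj_lin pQ)).
by move/esym/eqP; rewrite scaler_eq0 (negPf v0) orbF => /eqP.
Qed.

(** Each squared cosine is an eigenvalue on the other side, hence 0, 1 or the other cosine. As 1 is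
    always an eigenvalue because of [M], that case is settled separately: it means equal lines, and
    [phi] is injective. *)
Lemma line_image_abs M x y u v : biinfinite M -> ip x x = 1 -> ip y y = 1 ->
  M x = 0 -> M y = 0 -> line_image M x u -> line_image M y v -> `|ip u v| = `|ip x y|.
Proof.
move=> bM xx yy Mx My [uu Mu eu] [vv Mv ev]; have [iM _] := bM.
have pM := infinite_is_proj iM; have pM' := phi_proj iM.
have bP := biinfinite_add_line bM xx Mx; have bQ := biinfinite_add_line bM yy My.
have [[iP _] [iQ _]] := (bP, bQ); have ang := phi_angle iP iQ.
have one : `|ip u v| ^+ 2 = 1 <-> `|ip x y| ^+ 2 = 1.
  split=> [/(add_line_eq uu vv Mu Mv)|/(add_line_eq xx yy Mx My) E].
    by rewrite -eu -ev => /(phi_inj bP bQ)/(add_line_eq xx yy Mx My).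
  by apply/(add_line_eq uu vv Mu Mv); rewrite -eu -ev E.
have unit0 w : ip w w = 1 -> w != 0.
  by move=> ww; rewrite -ip_eq0 ww oner_eq0.
have h1 : [\/ `|ip u v| ^+ 2 = 0, `|ip u v| ^+ 2 = 1 | `|ip u v| ^+ 2 = `|ip x y| ^+ 2].
  have [W [uW WT]] := ang; have [lW iW _] := uW.
  apply: (add_line_eigenvalue pM xx yy Mx My (v := W v)); first by rewrite unit0 ?iW.
  by have := WT v; rewrite /= eu ev add_line_QPQ // (linear_scale lW) => <-.
have h2 : [\/ `|ip x y| ^+ 2 = 0, `|ip x y| ^+ 2 = 1 | `|ip x y| ^+ 2 = `|ip u v| ^+ 2].
  have [W [uW WT]] := angle_sym ang; have [lW iW _] := uW.
  apply: (add_line_eigenvalue pM' uu vv Mu Mv (v := W y)); first by rewrite unit0 ?iW.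
  by have := WT y; rewrite /= eu ev add_line_QPQ // (linear_scale lW) => <-.
apply/eqP; rewrite -(eqrXn2 (n := 2)) //; apply/eqP.
case: h1 => [c0|c1|//]; last by rewrite c1 (one.1 c1).
by case: h2 => [d0|d1|->//]; [rewrite c0 d0 | rewrite d1 (one.2 d1)].
Qed.

Definition parallel (u v : H) := exists2 c, c != 0 & u = c *: v.

Lemma parallel_sym u v : parallel u v -> parallel v u.
Proof.
move=> [c c0 ->]; exists c^-1; first by rewrite invr_eq0.
by rewrite scalerA mulVf // scale1r.
Qed.

Lemma parallel_trans v u w : parallel u v -> parallel v w -> parallel u w.
Proof.
by move=> [c c0 ->] [d d0 ->]; exists (c * d); rewrite ?mulf_neq0 // scalerA.
Qed.

(** [M + x] commutes with [N], so [phi N u] is a multiple of [u], hence 0 or [u]. The value [u]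
    would put [M + x] below [N]; so it is 0, and [u], lying in the range of [phi (N + x)], is on the
    line of [v]. *)
Lemma line_image_mono M N x u v : biinfinite M -> biinfinite N -> ip x x = 1 ->
  N x = 0 -> le_proj M N -> line_image M x u -> line_image N x v -> parallel u v.
Proof.
move=> bM bN xx Nx MN [uu Mu eu] [vv Nv ev].
have [[iM _] [iN _]] := (bM, bN); have pM := infinite_is_proj iM;
  have pN := infinite_is_proj iN.
have Mx : M x = 0 by rewrite -(le_proj_comp pM pN MN) Nx (linear0 (proj_lin pM)).
have bP := biinfinite_add_line bM xx Mx; have [iP _] := bP.
have bQ := biinfinite_add_line bN xx Nx; have [iQ _] := bQ.
have cP : commuting (add_line M x) N.
  move=> z; rewrite /add_line (linear_add (proj_lin pN)) (linear_scale (proj_lin pN)) Nx.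
  by rewrite scaler0 MN (le_proj_comp pM pN MN) (proj_adj pN) Nx ip0r scale0r.
have := phi_comm iP iN cP u; rewrite eu add_line_self // /add_line.
have MN' := (phi_le iM bN).1 MN.
rewrite (le_proj_comp (phi_proj iM) (phi_proj iN) MN') Mu add0r => Nu.
have Nu0 : phi N u = 0.
  have := proj_idem (phi_proj iN) u; rewrite -{1}Nu (linear_scale (proj_lin (phi_proj iN))).
  have [-> //|n0] := eqVneq (phi N u) 0.
  move/eqP; rewrite -subr_eq0 -[X in _ - X]scale1r -scalerBl scaler_eq0 (negPf n0) orbF.
  rewrite subr_eq0 => /eqP c1; move: Nu; rewrite c1 scale1r => Nu.
  have : le_proj (add_line M x) N.
    by apply/(phi_le iP bN); rewrite eu; apply: add_line_le => //; exact/proj_lin/phi_proj.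
  move/(_ x); rewrite add_line_self // Nx => x0.
  by move/eqP: xx; rewrite -x0 ip0l eq_sym oner_eq0.
have PQ : le_proj (add_line M x) (add_line N x).
  apply: add_line_le; [exact/proj_lin/proj_add_line | | exact: add_line_self].
  exact: le_proj_trans MN (le_add_line pN Nx).
have := (phi_le iP bQ).1 PQ u; rewrite eu ev add_line_self // {1}/add_line Nu0 add0r => E.
exists (ip u v) => //; apply: contra_eq_neq uu => c0.
by rewrite -E c0 scale0r ip0l eq_sym oner_eq0.
Qed.

(** [M] and [N] need not have a biinfinite upper bound, so [line_image_mono] is applied along a
    zigzag: [M] above [M1], [M1] and [N1] both below [S], and [N1] below [N]. *)
Lemma line_image_indep M N x u v : biinfinite M -> biinfinite N -> ip x x = 1 ->
  M x = 0 -> N x = 0 -> line_image M x u -> line_image N x v -> parallel u v.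
Proof.
move=> bM bN xx Mx Nx Lu Lv.
have [[[pM infM] _] [[pN infN] _]] := (bM, bN).
(* Even terms lie in [M] and odd terms in [N]. Indices [4k] span [M1], indices [4k + 1] span [N1],
   both together span [S], and indices [4k + 2] keep the complement of [S] infinite. *)
have [|m [mP om]] := @exists_on_seq (fun k w => if odd k then N w = w else M w = w).
  by move=> k l; case: (odd k).
have mx k : ip (m k) x = 0.
  move: (mP k); case: (odd k) => <-; first by rewrite (proj_adj pN) Nx ip0r.
  by rewrite (proj_adj pM) Mx ip0r.
have [M1 [pM1 M1A M10]] := span_projection (fun a => exists k, a = m (4 * k)%N).
have [N1 [pN1 N1A N10]] := span_projection (fun a => exists k, a = m (4 * k + 1)%N).
have [S [pS SA S0]] := span_projection (fun a => exists k j, (j < 2)%N /\ a = m (4 * k + j)%N).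
have Sx : S x = 0 by apply: S0 => _ [k [j [_ ->]]]; exact/ip_sym0/mx.
have bS : biinfinite S.
  split.
    apply: (infinite_of_seq (m := fun k => m (4 * k)%N)) => // [i j|k].
      by rewrite om; congr (_%:R); rewrite eqn_pmul2l.
    by apply: SA; exists k, 0%N; rewrite addn0.
  apply: (infinite_of_seq (m := fun k => m (4 * k + 2)%N)); first exact: proj_compl.
    by move=> i j; rewrite om; congr (_%:R); rewrite eqn_add2r eqn_pmul2l.
  move=> k; rewrite /compl_proj S0 ?subr0 // => _ [i [j [j2 ->]]]; rewrite om.
  by case: eqP => // E; exfalso; lia.
have M1S : le_proj M1 S.
  by apply: span_le pM1 pS M10 _ => _ [k ->]; apply: SA; exists k, 0%N; rewrite addn0.
have N1S : le_proj N1 S.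
  by apply: span_le pN1 pS N10 _ => _ [k ->]; apply: SA; exists k, 1%N.
have M1M : le_proj M1 M.
  apply: span_le pM1 pM M10 _ => _ [k ->]; have := mP (4 * k)%N.
  by rewrite oddM.
have N1N : le_proj N1 N.
  apply: span_le pN1 pN N10 _ => _ [k ->]; have := mP (4 * k + 1)%N.
  by rewrite oddD oddM.
have bM1 : biinfinite M1.
  apply: biinfinite_le bS M1S.
  apply: (infinite_of_seq (m := fun k => m (4 * k)%N)) => // [i j|k].
    by rewrite om; congr (_%:R); rewrite eqn_pmul2l.
  by apply: M1A; exists k.
have bN1 : biinfinite N1.
  apply: biinfinite_le bS N1S.
  apply: (infinite_of_seq (m := fun k => m (4 * k + 1)%N)) => // [i j|k].
    by rewrite om; congr (_%:R); rewrite eqn_add2r eqn_pmul2l.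
  by apply: N1A; exists k.
have zero A B : is_projection ip A -> is_projection ip B -> le_proj A B -> B x = 0 -> A x = 0.
  by move=> pA pB AB Bx; rewrite -(le_proj_comp pA pB AB) Bx (linear0 (proj_lin pA)).
have [w Lw] := exists_line_image bS xx Sx.
have [u1 Lu1] := exists_line_image bM1 xx (zero _ _ pM1 pM M1M Mx).
have [v1 Lv1] := exists_line_image bN1 xx (zero _ _ pN1 pN N1N Nx).
apply: (@parallel_trans u1).
  exact/parallel_sym/(line_image_mono bM1 bM xx Mx M1M Lu1 Lu).
apply: (@parallel_trans w); first exact: (line_image_mono bM1 bS xx Sx M1S Lu1 Lw).
apply: (@parallel_trans v1); last exact: (line_image_mono bN1 bN xx Nx N1N Lv1 Lv).
exact/parallel_sym/(line_image_mono bN1 bS xx Sx N1S Lv1 Lw).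
Qed.

Lemma infinite_lines : exists chi : H -> H,
  (forall M x, biinfinite M -> ip x x = 1 -> M x = 0 -> line_image M x (chi x)) /\
  (forall x y, ip x x = 1 -> ip y y = 1 -> `|ip (chi x) (chi y)| = `|ip x y|).
Proof.
have /choice[chi chiP] x : exists u, ip x x = 1 ->
    forall M, biinfinite M -> M x = 0 -> line_image M x u.
  have [xx|nxx] := pselect (ip x x = 1); last by exists 0.
  have [N [bN _ Nx]] := exists_biinfinite [:: x] H_inf.
  have {}Nx : N x = 0 by apply: Nx; exact: mem_head.
  have [u Lu] := exists_line_image bN xx Nx; exists u => _ M bM Mx.
  have [v Lv] := exists_line_image bM xx Mx.
  have [c c0 vu] := line_image_indep bM bN xx Mx Nx Lv Lu.
  have [uu _ _] := Lu; have [vv Mv ev] := Lv; have [iM _] := bM.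
  have Mu : phi M u = 0.
    have : c *: phi M u = 0 by rewrite -(linear_scale (proj_lin (phi_proj iM))) -vu.
    by move/eqP; rewrite scaler_eq0 (negPf c0) => /eqP.
  split=> //; rewrite ev; apply/add_line_eq => //.
  move: vv; rewrite vu !(ipZl, ipZr) uu !mulr1 (mul_conj cK) //.
exists chi; split=> [M x bM xx Mx|x y xx yy]; first exact: chiP.
have [M [bM _ M0]] := exists_biinfinite [:: x; y] H_inf.
have Mx : M x = 0 by apply: M0; rewrite !inE eqxx.
have My : M y = 0 by apply: M0; rewrite !inE eqxx orbT.
exact: (line_image_abs bM xx yy Mx My (chiP x xx M bM Mx) (chiP y yy M bM My)).
Qed.

(** * The Wigner isometry implements the map *)

Section Implemented.
Variables (chi V Vs : H -> H) (s : K -> K).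
Hypothesis chiP : forall M x, biinfinite M -> ip x x = 1 -> M x = 0 -> line_image M x (chi x).
Hypothesis s_aut : field_aut s.
Hypothesis V_semi : forall a x y, V (a *: x + y) = s a *: V x + V y.
Hypothesis V_isom : is_isometry ip V.
Hypothesis V_chi : forall x, ip x x = 1 -> exists c, V x = c *: chi x.
Hypothesis VsP : forall x y, ip (V x) y = s (ip x (Vs y)).

(** Split the line of [x] off [P]: then [phi P] is the image of the remainder plus the line of
    [chi x], which also contains [V x]. *)
Lemma phi_range P x : biinfinite P -> P x = x -> phi P (V x) = V x.
Proof.
move=> bP Px; have [iP _] := bP; have lP' := proj_lin (phi_proj iP).
have [->|x0] := eqVneq x 0; first by rewrite (semilin0 s_aut V_semi) (linear0 lP').
have [a a0 uu] := exists_unit x0.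
have Pu : P (a *: x) = a *: x by rewrite (linear_scale (proj_lin (infinite_is_proj iP))) Px.
have [uc Mc] := chiP (biinfinite_sub_line bP uu Pu) uu (sub_line_self uu Pu).
rewrite sub_lineK => E; have := add_line_self uc Mc; rewrite -E => {uc Mc E} Pc.
have sa0 : s a != 0 by rewrite -normr_eq0 (norm_field_aut _ s_aut) normr_eq0 gt_eqF.
have : phi P (s a *: V x) = s a *: V x.
  rewrite -(semilin_scale s_aut V_semi); have [c ->] := V_chi uu.
  by rewrite (linear_scale lP') Pc.
by rewrite (linear_scale lP') => /(scalerI sa0).
Qed.

Lemma phi_intertwine P x : biinfinite P -> phi P (V x) = V (P x).
Proof.
move=> bP; have [iP _] := bP; have pP := infinite_is_proj iP.
have lP' := proj_lin (phi_proj iP).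
rewrite -{1}(subrK (P x) x) (semilin_add s_aut V_semi) (linear_add lP').
rewrite [X in _ + X]phi_range // ?(proj_idem pP) //.
suff -> : phi P (V (x - P x)) = 0 by rewrite add0r.
have := @phi_range (compl_proj P) (x - P x) (biinfinite_compl bP).
rewrite phi_compl // /compl_proj (linear_sub (proj_lin pP)) (proj_idem pP) subrr subr0.
by move=> /(_ erefl) E; rewrite -[LHS](subKr (V (x - P x))) E subrr.
Qed.

Lemma V_inj : injective V.
Proof.
move=> x y E; apply/eqP; rewrite -subr_eq0 -ip_eq0 -V_isom.
by rewrite (semilin_sub s_aut V_semi) E subrr ip0l.
Qed.

(** For a unit vector [w], pull a pair [T < T + w] back to [M < P] and take [x] in [P] orthogonal to
    [M]. Then [chi x] lies in [T + w] and is orthogonal to [T], so it is a multiple of [w]. *)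
Lemma V_surj y : exists x, y = V x.
Proof.
have [->|y0] := eqVneq y 0; first by exists 0; rewrite (semilin0 s_aut V_semi).
suff unit_case w : ip w w = 1 -> exists x, w = V x.
  have [a a0 /unit_case[x Ex]] := exists_unit y0; exists (s a^-1 *: x).
  by rewrite (semilin_scale s_aut V_semi) (field_autK s_aut) -Ex scalerA mulVf ?gt_eqF //
    scale1r.
move=> ww; have [T [bT _ Tw]] := exists_biinfinite [:: w] H_inf.
have {}Tw : T w = 0 by apply: Tw; exact: mem_head.
have bP' := biinfinite_add_line bT ww Tw.
have [[iT _] [iP' _]] := (bT, bP').
have [M iM eM] := phi_surj iT; have [P iP eP] := phi_surj iP'.
have bM : biinfinite M by apply: phi_biinf_inv; rewrite // eM.
have bP : biinfinite P by apply: phi_biinf_inv; rewrite // eP.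
have pT := infinite_is_proj iT; have pP := infinite_is_proj iP.
have MP : le_proj M P by apply/(phi_le iM bP); rewrite eM eP; exact: le_add_line.
have nPM : ~ le_proj P M.
  move/(phi_le iP bM); rewrite eM eP => /(_ w); rewrite add_line_self // Tw => w0.
  by move/eqP: ww; rewrite -w0 ip0l eq_sym oner_eq0.
have [x [xx Px Mx]] := exists_between (infinite_is_proj iM) pP MP nPM.
have [cc Mc ec] := chiP bM xx Mx.
have bA := biinfinite_add_line bM xx Mx; have [iA _] := bA.
have AP : le_proj (add_line M x) P by apply: add_line_le => //; exact: proj_lin.
have := (phi_le iA bP).1 AP (chi x).
rewrite ec eP add_line_self // {1}/add_line -eM Mc add0r => E.
have [c Vc] := V_chi xx.
have c0 : c != 0.
  apply: contra_eq_neq xx => c0; rewrite -V_isom Vc c0 scale0r ip0l eq_sym.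
  exact: oner_neq0.
have d0 : ip (chi x) w != 0.
  apply: contra_eq_neq cc => d0; rewrite -E d0 scale0r ip0l eq_sym; exact: oner_neq0.
exists (s (c * ip (chi x) w)^-1 *: x).
have -> : V (s (c * ip (chi x) w)^-1 *: x) = (c * ip (chi x) w)^-1 *: V x.
  by rewrite (semilin_scale s_aut V_semi) (field_autK s_aut).
have -> : V x = (c * ip (chi x) w) *: w by rewrite Vc -{1}E scalerA.
by rewrite scalerA mulVf ?scale1r // mulf_neq0.
Qed.

Lemma V_adjoint_right y : V (Vs y) = y.
Proof.
apply: ip_injl => z; have [x ->] := V_surj z; rewrite ipC [RHS]ipC; congr conj.
by rewrite (semilin_ip s_aut V_semi V_isom) VsP.
Qed.

(* A projection [P] of finite corank is recovered from the biinfinite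
   projections commuting with it. *)
Section FiniteCorank.
Variable P : H -> H.
Hypothesis iP : infinite_proj P.

Let D x := Vs (phi P (V x)).

Lemma V_D x : V (D x) = phi P (V x).
Proof. exact: V_adjoint_right. Qed.

Lemma D_linear : is_linear D.
Proof.
move=> a x y; apply: V_inj; rewrite V_D !V_semi !V_D.
by rewrite (linear_add (proj_lin (phi_proj iP))) (linear_scale (proj_lin (phi_proj iP))).
Qed.

Lemma D_idem x : D (D x) = D x.
Proof. by apply: V_inj; rewrite !V_D (proj_idem (phi_proj iP)). Qed.

Lemma D_comm R : biinfinite R -> commuting R P -> commuting R D.
Proof.
move=> bR cR x; have [iR _] := bR; apply: V_inj.
by rewrite V_D -(phi_intertwine (D x) bR) -(phi_intertwine x bR) V_D (phi_comm iR iP cR).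
Qed.

(** For a biinfinite [T] below [P] with [T x = 0], both [T] and [T + x] commute with [P], hence with
    [D]. So [D] preserves the line of [x], and it is idempotent. *)
Lemma D_eigen x : P x = x \/ P x = 0 -> D x = 0 \/ D x = x.
Proof.
move=> Px; have lD := D_linear; have [->|x0] := eqVneq x 0; first by left; rewrite (linear0 lD).
suff [c Dx] : exists c, D x = c *: x.
  have := D_idem x; rewrite {1}Dx (linear_scale lD).
  have [D0|D0] := eqVneq (D x) 0; first by left.
  move/eqP; rewrite -subr_eq0 -[X in _ - X]scale1r -scalerBl scaler_eq0 (negPf D0) orbF.
  by rewrite subr_eq0 => /eqP c1; right; rewrite Dx c1 scale1r.
have pP := infinite_is_proj iP.
have [a a0 uu] := exists_unit x0.
have [T [bT TP Tu]] := exists_biinfinite [:: a *: x] iP.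
have {}Tu : T (a *: x) = 0 by apply: Tu; exact: mem_head.
have pT := biinfinite_proj bT.
have Pu : P (a *: x) = a *: x \/ P (a *: x) = 0.
  by rewrite (linear_scale (proj_lin pP)); case: Px => ->; [left | right; rewrite scaler0].
have TP' := le_proj_comp pT pP TP.
have cT : commuting T P by move=> z; rewrite TP TP'.
have cA : commuting (add_line T (a *: x)) P.
  move=> z; rewrite /add_line (linear_add (proj_lin pP)) (linear_scale (proj_lin pP)) cT.
  by congr (_ + _); rewrite (proj_adj pP); case: Pu => ->; rewrite ?ip0r ?scale0r ?scaler0.
have := D_comm (biinfinite_add_line bT uu Tu) cA (a *: x).
rewrite add_line_self // /add_line (D_comm bT cT) Tu (linear0 lD) add0r (linear_scale lD).
set c := ip _ _ => E; exists (a^-1 * (c * a)).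
by rewrite -!scalerA E scalerA mulVf ?gt_eqF // scale1r.
Qed.

(** If [D x = 0] and [D y = y], then [D (x + y) = y] must be 0 or [x + y], so one of [x], [y] is
    0. *)
Lemma D_uniform Q : is_linear Q -> (forall x, Q x = x -> P x = x \/ P x = 0) ->
  (forall x, Q x = x -> D x = 0) \/ (forall x, Q x = x -> D x = x).
Proof.
move=> lQ QP; have [|/existsNP[x /not_implyP[Qx Dx]]] := pselect (forall x, Q x = x -> D x = x).
  by right.
have Dx0 : D x = 0 by case: (D_eigen (QP _ Qx)).
left=> y Qy; case: (D_eigen (QP _ Qy)) => // Dy.
have : D (x + y) = y by rewrite (linear_add D_linear) Dx0 Dy add0r.
case: (D_eigen (QP (x + y) _)) => [|-> y0|->].
- by rewrite (linear_add lQ) Qx Qy.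
- by rewrite Dy.
- by move/eqP; rewrite -subr_eq0 addrK => /eqP x0; case: Dx; rewrite x0 (linear0 D_linear).
Qed.

Lemma phi_intertwine_cofinite x : ~ infinite_proj (compl_proj P) -> phi P (V x) = V (P x).
Proof.
move=> nC; have pP := infinite_is_proj iP; have pC := proj_compl pP.
rewrite -V_D; congr V.
have decomp y : y = P y + compl_proj P y by rewrite addrC subrK.
have CP y : P (compl_proj P y) = 0.
  by rewrite (linear_sub (proj_lin pP)) (proj_idem pP) subrr.
have CfixP y : compl_proj P y = y -> P y = 0.
  by move=> <-; rewrite CP.
(* If [D] vanished on the range of [P], the infinite range of [phi P] would pull back under [V] into
   the kernel of [P], which is finite dimensional. *)
have [P0|P1] := @D_uniform P (proj_lin pP) (fun y Py => or_introl Py).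
  case: nC; split=> // l; have [_ inf] := phi_inf iP.
  have [v [Pv vv vl]] := inf (map V l); have [w ew] := V_surj v.
  have Dw : D w = w by apply: V_inj; rewrite V_D -ew.
  have w0 : w != 0.
    by apply: contra_eq_neq vv => w0; rewrite ew V_isom w0 ip0l eq_sym oner_neq0.
  have Dw' : D w = D (compl_proj P w).
    by rewrite {1}(decomp w) (linear_add D_linear) P0 ?(proj_idem pP) ?add0r.
  have Cw : compl_proj P w = w.
    case: (D_eigen (or_intror (CP w))) => E; last by rewrite -E -Dw' Dw.
    by rewrite Dw' E in Dw; rewrite -Dw eqxx in w0.
  exists w; split=> //; first by rewrite -V_isom -ew.
  move=> y yl; apply: (can_inj (field_autK s_aut)).
  by rewrite -(semilin_ip s_aut V_semi V_isom) -ew vl ?map_f // (field_aut0 s_aut).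
have DP y : D (P y) = P y by apply: P1; rewrite (proj_idem pP).
have [C0|C1] := @D_uniform _ (proj_lin pC) (fun y Cy => or_intror (CfixP y Cy)).
  rewrite {1}(decomp x) (linear_add D_linear) DP C0 ?addr0 //; exact: proj_idem.
have Did y : D y = y.
  rewrite {1}(decomp y) (linear_add D_linear) DP C1 -?decomp //; exact: proj_idem.
have phi1 y : phi P y = y by have [z ->] := V_surj y; rewrite -V_D Did.
(* Here [phi P] is the identity. As [PPP] is unitarily equivalent to it, [P] is the identity as
   well. *)
have [W [[lW _ sW] WT]] := phi_angle iP iP; rewrite Did.
have [y ->] := sW x; have := WT y; rewrite /= !phi1 => {1}->.
by rewrite (proj_idem pP) (proj_idem pP).
Qed.

End FiniteCorank.

Lemma phi_implemented P : infinite_proj P -> phi P = V \o P \o Vs.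
Proof.
move=> iP; apply/funext => y /=; rewrite -{1}(V_adjoint_right y).
have [iC|nC] := pselect (infinite_proj (compl_proj P)); first exact: phi_intertwine.
exact: phi_intertwine_cofinite.
Qed.

End Implemented.

Lemma infinite_case : exists U Us : H -> H,
  ((h_unitary ip U /\ is_adjoint ip U Us) \/
   (h_antiunitary conj ip U /\ is_conj_adjoint conj ip U Us)) /\
  (forall P, infinite_proj P -> phi P = U \o P \o Us).
Proof.
have [chi [chiP chi_abs]] := infinite_lines.
have [V [s [V_isom s_aut V_semi V_chi]]] := wigner chi_abs.
have [Vs VsP] := semilin_adjoint s_aut V_semi V_isom.
exists V, Vs; split; last exact: (phi_implemented chiP s_aut V_semi V_isom V_chi VsP).
have sV := V_surj chiP s_aut V_semi V_isom V_chi.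
by case: (semilinear_cases s_aut V_semi VsP) => -[lV aV]; [left | right]; split.
Qed.

End InfiniteRank.
End HilbertSpace.

Theorem mainTheorem1 (R : realType) (b : bool) (H : lmodType (scal R b))
    (ip : H -> H -> scal R b) (hH : is_hilbert (cj R b) ip) :
  (forall (n : nat) (phi : (H -> H) -> (H -> H)),
     dim_ge H n ->
     (forall P, proj_rank ip n P -> proj_rank ip n (phi P)) ->
     (forall P Q, proj_rank ip n P -> proj_rank ip n Q ->
        angle_eq ip (phi P) (phi Q) P Q) ->
     (n = 1%N \/ ~ has_dim H (n + n)%N) ->
     exists V Vs : H -> H,
       is_isometry ip V /\
       ((is_linear V /\ is_adjoint ip V Vs) \/
        (is_conj_linear (cj R b) V /\ is_conj_adjoint (cj R b) ip V Vs)) /\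
       (forall P, proj_rank ip n P -> phi P = V \o P \o Vs))
  /\
  (inf_dim H ->
   forall phi : (H -> H) -> (H -> H),
     (forall P, proj_inf_rank ip P -> proj_inf_rank ip (phi P)) ->
     (forall Q, proj_inf_rank ip Q -> exists P, proj_inf_rank ip P /\ phi P = Q) ->
     (forall P Q, proj_inf_rank ip P -> proj_inf_rank ip Q ->
        angle_eq ip (phi P) (phi Q) P Q) ->
     exists U Us : H -> H,
       ((h_unitary ip U /\ is_adjoint ip U Us) \/
        (h_antiunitary (cj R b) ip U /\ is_conj_adjoint (cj R b) ip U Us)) /\
       (forall P, proj_inf_rank ip P -> phi P = U \o P \o Us)).
Proof.
have [ipP ip_complete] := hH; have cK := conj_field_scal R b.
split=> [n phi _ phi_rank phi_angle dimH|infH phi phi_inf phi_surj phi_angle].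
  exact: (finite_case cK ipP ip_complete phi_rank phi_angle dimH).
have infP := infinite_projP cK ipP.
have H_inf : infinite_proj ip id.
  split; first by apply: (projI cK ipP).
  move=> l; have [u [_ uu ul]] := dim_ge_orth_unit cK ipP (infH _) (ltnSn (size l)).
  by exists u.
have [|||U [Us [uU UP]]] := @infinite_case _ _ _ _ cK ipP ip_complete phi _ _ _ H_inf.
- by move=> P /infP/phi_inf/infP.
- by move=> Q /infP/phi_surj[P [/infP iP eP]]; exists P.
- by move=> P Q /infP iP /infP; exact: phi_angle.
by exists U, Us; split=> // P /infP; exact: UP.
Qed.
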